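(* Let $D,H,G$ be the semirings defined in the context and let $\mathcal W$ be the variety generated by $\{H,D,G\}$. The variety $\mathcal W$ and the $18$-element semiring $H\times D\times G$ are nonfinitely based, although each of $H$, $D$, $G$ is finitely based.
   Context: A semiring is a nonempty algebra $(S,+,\cdot)$ in the signature of two binary operations (no constants) in which both operations are associative and multiplication distributes over addition on both sides. A variety is finitely based if it is the class of models of a finite set of identities, and nonfinitely based otherwise; an algebra is (non)finitely based if the variety it generates is. The test semirings are as follows (element names are labels, not constants of the signature). $D=\{0,1\}$ is the two-element distributive lattice, with join as addition and meet as multiplication. $H=\{1,a,\infty\}$ has addition equal to the join (maximum) in the chain $1<a<\infty$, and its commutative multiplication has identity $1$, $a\cdot a=\infty$, and $\infty$ absorbing. $G=\{1,g,\infty\}$ has addition $x+x=x$ and $x+y=\infty$ for $x\neq y$, and its commutative multiplication has identity $1$, $g\cdot g=1$, and $\infty$ absorbing. All three have commutative idempotent addition and commutative multiplication. *)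

(* Defs.v *)
From Stdlib Require List.
From mathcomp Require Import all_boot.

Set Implicit Arguments.
Unset Strict Implicit.
Unset Printing Implicit Defensive.

(* The signature has two binary operations and no constants, so MathComp's
   semirings (which have 0 and 1) do not apply. *)
Record algebra : Type := Algebra {
  carrier :> Type;
  add : carrier -> carrier -> carrier;
  mul : carrier -> carrier -> carrier;
  nonempty : inhabited carrier
}.

Definition is_semiring (A : algebra) : Prop :=
  [/\ associative (@add A), associative (@mul A),
      left_distributive (@mul A) (@add A)
    & right_distributive (@mul A) (@add A)].

Definition prod_algebra (A B : algebra) : algebra :=
  @Algebra (A * B)%type
    (fun x y => (add x.1 y.1, add x.2 y.2))
    (fun x y => (mul x.1 y.1, mul x.2 y.2))
    (let: inhabits a := nonempty A in
     let: inhabits b := nonempty B in inhabits (a, b)).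

Inductive term : Type :=
| Var of nat
| Add of term & term
| Mul of term & term.

Fixpoint eval (A : algebra) (v : nat -> A) (t : term) : A :=
  match t with
  | Var n => v n
  | Add t1 t2 => add (eval v t1) (eval v t2)
  | Mul t1 t2 => mul (eval v t1) (eval v t2)
  end.

Definition identity : Type := (term * term)%type.

Definition satisfies (A : algebra) (e : identity) : Prop :=
  forall v : nat -> A, eval v e.1 = eval v e.2.

Definition is_model (S : identity -> Prop) (A : algebra) : Prop :=
  forall e, S e -> satisfies A e.

(* Models are taken among all nonempty algebras of the signature; the semiring
   laws are finitely many identities, so working inside the class of semirings
   would give the same notion of finite basis. *)
Definition is_variety (V : algebra -> Prop) : Prop :=
  exists S : identity -> Prop, forall A, V A <-> is_model S A.

Definition generated_variety (K : algebra -> Prop) : algebra -> Prop :=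
  fun A => forall V : algebra -> Prop,
    is_variety V -> (forall B, K B -> V B) -> V A.

Definition finitely_based_variety (V : algebra -> Prop) : Prop :=
  exists s : seq identity,
    forall A, V A <-> is_model (fun e => List.In e s) A.

Definition finitely_based (A : algebra) : Prop :=
  finitely_based_variety (generated_variety (fun B => B = A)).

Lemma generated_variety_is_variety (K : algebra -> Prop) :
  is_variety (generated_variety K).
Proof.
exists (fun e => forall B, K B -> satisfies B e) => A; split=> [VA e Ke|mA V].
  apply: (VA (is_model (fun e => forall B, K B -> satisfies B e))) => //.
    by exists (fun e => forall B, K B -> satisfies B e).
  by move=> B KB e' Ke'; apply: Ke'.
move=> [S VS] KV; apply/VS => e Se; apply: mA => B KB.
by have /VS := KV _ KB; apply.
Qed.

Definition D : algebra := @Algebra bool orb andb (inhabits true).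

Inductive H_elt : Type := H1 | Ha | Hinf.

Definition H_add (x y : H_elt) : H_elt :=
  match x, y with
  | H1, z | z, H1 => z
  | Ha, Ha => Ha
  | _, _ => Hinf
  end.

Definition H_mul (x y : H_elt) : H_elt :=
  match x, y with
  | H1, z | z, H1 => z
  | _, _ => Hinf
  end.

Definition H : algebra := Algebra H_add H_mul (inhabits H1).

Inductive G_elt : Type := G1 | Gg | Ginf.

Definition G_add (x y : G_elt) : G_elt :=
  match x, y with
  | G1, G1 => G1
  | Gg, Gg => Gg
  | _, _ => Ginf
  end.

Definition G_mul (x y : G_elt) : G_elt :=
  match x, y with
  | G1, z | z, G1 => z
  | Gg, Gg => G1
  | _, _ => Ginf
  end.

Definition G : algebra := Algebra G_add G_mul (inhabits G1).

Lemma D_semiring : is_semiring D.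
Proof. by split; do 3!case. Qed.

Lemma H_semiring : is_semiring H.
Proof. by split; do 3!case. Qed.

Lemma G_semiring : is_semiring G.
Proof. by split; do 3!case. Qed.

Lemma prod_semiring (A B : algebra) :
  is_semiring A -> is_semiring B -> is_semiring (prod_algebra A B).
Proof.
move=> [aA mA lA rA] [aB mB lB rB].
split=> x y z; congr (_, _); first [exact: aA | exact: aB | exact: mA
  | exact: mB | exact: lA | exact: lB | exact: rA | exact: rB].
Qed.

Definition HDG : algebra := prod_algebra (prod_algebra H D) G.

Lemma HDG_semiring : is_semiring HDG.
Proof.
exact: prod_semiring (prod_semiring H_semiring D_semiring) G_semiring.
Qed.

Definition HDG_enum : seq HDG :=
  [seq (xy, z) | xy <- [seq (x, y) | x <- [:: H1; Ha; Hinf], y <- [:: false; true]],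
                 z <- [:: G1; Gg; Ginf]].

Lemma HDG_enumP :
  [/\ size HDG_enum = 18, List.NoDup HDG_enum & forall x, List.In x HDG_enum].
Proof.
split=> //; last by move=> [[[] []] []] /=; intuition.
by rewrite /HDG_enum /=; repeat constructor; rewrite /=; intuition discriminate.
Qed.

Definition W : algebra -> Prop :=
  generated_variety (fun A => [\/ A = H, A = D | A = G]).

(* Main.v *)
From HB Require Import structures.
From mathcomp Require Import all_boot all_algebra zify.
Require Import Defs.

(* A term is a sum of words, and validity of identities is controlled in D by
   the minimal supports of words, in H by the pairs of (possibly equal) variables
   that occur together in a word, and in G by the variables of the term and the
   affine span over F_2 of the exponent vectors of its words. For each single
   semiring these data yield an explicit finite basis.

   For the join, take a family F of sets of variables (a sum of square-free
   words) and a further set T such that T contains a member of F, every pair of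
   elements of T lies in a member of F, and T is in the affine span of F modulo
   2. Then F = F + T holds in D, H and G. If moreover T is the only set outside F
   with these three properties, and the only member of F inside T is {0}, then an identity u = t of W can turn
   F into something else only by producing T as an instance of a word w of t.
   As 0 belongs to the value of one variable of w, the pair condition for u
   forces each of the other variables to take a value with at most one element
   besides 0; so w has at least |T| - 1 variables, and identities of bounded
   size do not suffice. The counterexample to an identity basis is the Rees
   quotient of a semiring of set families in which only the divisors of F
   survive. *)

Set Implicit Arguments.
Unset Strict Implicit.
Unset Printing Implicit Defensive.

(** * Words of a term, and the values of terms in [D], [H] and [G] *)

Fixpoint words (t : term) : seq (seq nat) :=
  match t with
  | Var n => [:: [:: n]]
  | Add t1 t2 => words t1 ++ words t2
  | Mul t1 t2 => [seq w1 ++ w2 | w1 <- words t1, w2 <- words t2]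
  end.

Lemma words_Add t1 t2 w :
  (w \in words (Add t1 t2)) = (w \in words t1) || (w \in words t2).
Proof. exact: mem_cat. Qed.

Lemma words_MulP t1 t2 w :
  reflect (exists w1 w2, [/\ w1 \in words t1, w2 \in words t2 & w = w1 ++ w2])
          (w \in words (Mul t1 t2)).
Proof.
apply: (iffP allpairsP) => [[[w1 w2] [h1 h2 ->]]|[w1 [w2 [h1 h2 ->]]]].
  by exists w1, w2.
by exists (w1, w2).
Qed.

Lemma words_Mul t1 t2 w1 w2 : w1 \in words t1 -> w2 \in words t2 ->
  w1 ++ w2 \in words (Mul t1 t2).
Proof. by move=> h1 h2; apply/words_MulP; exists w1, w2. Qed.

Lemma words_nonempty t : exists w, w \in words t.
Proof.
elim: t => [n|t1 [w1 h1] t2 _|t1 [w1 h1] t2 [w2 h2]].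
- by exists [:: n]; rewrite inE.
- by exists w1; rewrite words_Add h1.
- by exists (w1 ++ w2); apply: words_Mul.
Qed.

Lemma word_neq0 t w : w \in words t -> w != [::].
Proof.
elim: t w => [n|t1 IH1 t2 IH2|t1 IH1 t2 IH2] w.
- by rewrite inE => /eqP->.
- by rewrite words_Add => /orP[/IH1|/IH2].
- by case/words_MulP => -[|x w1] [w2 [/IH1 h1 h2 ->]].
Qed.

Lemma evalD (v : nat -> D) t : eval v t = has (all v) (words t).
Proof.
elim: t => [n|t1 IH1 t2 IH2|t1 IH1 t2 IH2] /=.
- by rewrite andbT orbF.
- by rewrite has_cat IH1 IH2.
rewrite IH1 IH2; apply/andP/hasP.
  move=> [/hasP[w1 m1 h1] /hasP[w2 m2 h2]].
  by exists (w1 ++ w2); [exact: words_Mul | rewrite all_cat h1 h2].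
case=> w /words_MulP[w1 [w2 [m1 m2 ->]]]; rewrite all_cat => /andP[h1 h2].
by split; apply/hasP; [exists w1 | exists w2].
Qed.

(* [hval] identifies [H] with the max-plus semiring on {0, 1, 2}, in which sums
   are truncated at 2. *)
Definition hval (x : H) : nat :=
  match x with H1 => 0 | Ha => 1 | Hinf => 2 end.

Definition hsum (v : nat -> H) (w : seq nat) : nat := \sum_(x <- w) hval (v x).

Lemma hval_inj : injective hval. Proof. by do 2!case. Qed.

Lemma hval_add (x y : H) : hval (add x y) = maxn (hval x) (hval y).
Proof. by case: x y => [] []. Qed.

Lemma hval_mul (x y : H) : hval (mul x y) = minn 2 (hval x + hval y).
Proof. by case: x y => [] []. Qed.

Lemma hsum_cat v w1 w2 : hsum v (w1 ++ w2) = hsum v w1 + hsum v w2.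
Proof. exact: big_cat. Qed.

Lemma minn2D a b : minn 2 (minn 2 a + minn 2 b) = minn 2 (a + b).
Proof. lia. Qed.

(** With [evalH_ge] this makes the value in [H] the maximum of the truncated weights of the words.
    Truncation may be postponed to the end by [minn2D]. *)
Lemma evalH_attained (v : nat -> H) t :
  exists2 w, w \in words t & hval (eval v t) = minn 2 (hsum v w).
Proof.
elim: t => [n|t1 [w1 m1 h1] t2 [w2 m2 h2]|t1 [w1 m1 h1] t2 [w2 m2 h2]].
- exists [:: n]; first by rewrite inE.
  by rewrite /hsum big_seq1 /=; case: (v n).
- rewrite /= hval_add; case: (leqP (hval (eval v t1)) (hval (eval v t2))) => _.
    by exists w2; rewrite ?mem_cat ?m2 ?orbT.
  by exists w1; rewrite ?mem_cat ?m1.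
- exists (w1 ++ w2); first exact: words_Mul.
  by rewrite hsum_cat [LHS]hval_mul h1 h2 minn2D.
Qed.

Lemma evalH_ge (v : nat -> H) t w :
  w \in words t -> minn 2 (hsum v w) <= hval (eval v t).
Proof.
elim: t w => [n|t1 IH1 t2 IH2|t1 IH1 t2 IH2] w.
- by rewrite inE => /eqP->; rewrite /hsum big_seq1 geq_minr.
- rewrite words_Add hval_add leq_max.
  by case/orP => [/IH1|/IH2] ->; rewrite ?orbT.
case/words_MulP => w1 [w2 [/IH1 h1 /IH2 h2 ->]].
rewrite hsum_cat hval_mul -minn2D leq_min geq_minl /=.
by apply: leq_trans (geq_minr _ _) _; exact: leq_add.
Qed.

Lemma evalH_transfer (v : nat -> H) u t w : satisfies H (u, t) ->
  w \in words t -> 1 < hsum v w -> exists2 w', w' \in words u & 1 < hsum v w'.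
Proof.
move=> /(_ v) /= e /(evalH_ge v) h lt.
have [w' m' h'] := evalH_attained v u; exists w' => //.
move: h; rewrite -e h'; lia.
Qed.

(** The units of [G] form a group of order two, here identified with [bool] under [(+)]. *)
Definition toG (b : bool) : G := if b then Gg else G1.

Lemma G_mulA : associative G_mul. Proof. by do 3!case. Qed.
Lemma G_mulC : commutative G_mul. Proof. by do 2!case. Qed.
Lemma G_mul1 : left_id G1 G_mul. Proof. by case. Qed.

HB.instance Definition _ := Monoid.isComLaw.Build G_elt G1 G_mul G_mulA G_mulC G_mul1.

Definition gprod (v : nat -> G) (w : seq nat) : G := \big[G_mul/G1]_(x <- w) v x.

(** Addition in [G] is flat: a sum is a unit only if all its summands are that same unit. For
    products, if all concatenations [w1 ++ w2] have the same unit as value, cancelling a fixed word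
    of one factor shows that the words of the other factor have a common value. *)
Lemma evalG (v : nat -> G) t c :
  eval v t = toG c <-> forall w, w \in words t -> gprod v w = toG c.
Proof.
elim: t c => [n|t1 IH1 t2 IH2|t1 IH1 t2 IH2] c /=.
- split=> [h w|/(_ [:: n])]; last by rewrite inE eqxx /gprod big_seq1; apply.
  by rewrite inE => /eqP->; rewrite /gprod big_seq1.
- have split_add (x y : G) : G_add x y = toG c <-> x = toG c /\ y = toG c.
    by case: c x y => [] [] []; split=> // [[]].
  rewrite split_add IH1 IH2; split=> [[h1 h2] w|h].
    by rewrite mem_cat => /orP[/h1|/h2].
  by split=> w m; apply: h; rewrite mem_cat m ?orbT.
have split_mul (x y : G) b : G_mul x y = toG b ->
    exists b1 b2, [/\ x = toG b1, y = toG b2 & b = b1 (+) b2].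
  by case: x y b => [] [] [] // _;
    [exists false, false|exists false, true|exists true, false|exists true, true].
have toGM b1 b2 : G_mul (toG b1) (toG b2) = toG (b1 (+) b2) by case: b1 b2 => [] [].
split.
  case/split_mul => c1 [c2 [/IH1 h1 /IH2 h2 ->]] w.
  case/words_MulP => w1 [w2 [/h1 g1 /h2 g2 ->]].
  by rewrite /gprod big_cat /= -toGM -g1 -g2.
have [w1 m1] := words_nonempty t1; have [w2 m2] := words_nonempty t2.
move=> h; have hM w w' : w \in words t1 -> w' \in words t2 ->
    G_mul (gprod v w) (gprod v w') = toG c.
  by move=> m m'; rewrite -(h (w ++ w')) ?words_Mul // /gprod big_cat.
have [c1 [c2 [g1 g2 ec]]] := split_mul _ _ _ (hM _ _ m1 m2).
have toG_inj : injective toG by do 2!case.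
suff [-> ->] : eval v t1 = toG c1 /\ eval v t2 = toG c2 by rewrite toGM ec.
split; [apply/IH1 | apply/IH2] => w m.
  have [b1 [b2 [-> /esym]]] := split_mul _ _ _ (hM _ _ m m2).
  by rewrite g2 => /toG_inj ->; rewrite ec => /addIb->.
have [b1 [b2 [/esym e1 -> e2]]] := split_mul _ _ _ (hM _ _ m1 m).
by move: e1 e2; rewrite g1 => /toG_inj ->; rewrite ec => /addbI->.
Qed.

(** * Finite bases of D, H and G *)

Lemma finitely_based_of_basis (A : algebra) (s : seq identity) :
    is_model (fun e => List.In e s) A ->
    (forall B e, is_model (fun e => List.In e s) B ->
       satisfies A e -> satisfies B e) ->
  finitely_based A.
Proof.
move=> mA complete; exists s => B; split=> [genB | mB V [S VS] VA].
  by apply: genB => [|_ ->] //; exists (fun e => List.In e s).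
apply/VS => e Se; apply: complete mB _.
by have /VS := VA A erefl; apply.
Qed.

(** Commutative semirings with commutative idempotent addition; the second distributive law follows
    from commutativity. Later lemmas read the laws off by their position. *)
Definition ai_basis : seq identity :=
  let x := Var 0 in let y := Var 1 in let z := Var 2 in
  [:: (Add x (Add y z), Add (Add x y) z); (Add x y, Add y x); (Add x x, x);
      (Mul x (Mul y z), Mul (Mul x y) z); (Mul x y, Mul y x);
      (Mul x (Add y z), Add (Mul x y) (Mul x z))].

(** Distributive lattices; the dual absorption law follows by distributivity. *)
Definition D_basis : seq identity :=
  let x := Var 0 in let y := Var 1 in
  [:: (Mul x x, x), (Add x (Mul x y), x) & ai_basis].

(** In the order of addition, products lie above their factors, a triple product is the join of its
    pair products, and a square times [y] is the join of the square and [y]. *)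
Definition H_basis : seq identity :=
  let x := Var 0 in let y := Var 1 in let z := Var 2 in
  [:: (Add x (Mul x y), Mul x y),
      (Mul x (Mul y z), Add (Add (Mul x y) (Mul y z)) (Mul x z)),
      (Mul (Mul x x) y, Add (Mul x x) y) & ai_basis].

(** The second law puts a product of three elements below their sum, which expresses closure under
    affine combinations modulo 2. The third lets the squares of summands act trivially on the
    sum. *)
Definition G_basis : seq identity :=
  let x := Var 0 in let y := Var 1 in let z := Var 2 in
  [:: (Mul x (Mul x x), x),
      (Add (Mul x (Mul y z)) (Add (Add x y) z), Add (Add x y) z),
      (Mul (Mul x x) (Mul (Mul y y) (Add x y)), Add x y) & ai_basis].

Lemma D_model : is_model (fun e => List.In e D_basis) D.
Proof.
move=> e /= in_e; have : List.In e D_basis := in_e.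
by rewrite /=; intuition; subst=> v /=; case: (v 0) (v 1) (v 2) => [] [] [].
Qed.

Lemma H_model : is_model (fun e => List.In e H_basis) H.
Proof.
move=> e /= in_e; have : List.In e H_basis := in_e.
by rewrite /=; intuition; subst=> v /=; case: (v 0) (v 1) (v 2) => [] [] [].
Qed.

Lemma G_model : is_model (fun e => List.In e G_basis) G.
Proof.
move=> e /= in_e; have : List.In e G_basis := in_e.
by rewrite /=; intuition; subst=> v /=; case: (v 0) (v 1) (v 2) => [] [] [].
Qed.

Lemma List_In_nth (T : Type) x0 (s : seq T) i :
  i < size s -> List.In (nth x0 s i) s.
Proof. by elim: s i => [|x s IH] [|i] //=; [left | right; apply: IH]. Qed.

(** * Commutative additively idempotent semirings and their natural order *)

Section AdditivelyIdempotent.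

Variables (A : algebra) (s : seq identity).
Hypothesis mA : is_model (fun e => List.In e s) A.

(** Variables 0 and 1 become [x] and [y]; variable 2 falls on the default value [z] of [nth]. *)
Lemma model_law i x y z : i < size s ->
  let e := nth (Var 0, Var 0) s i in
  eval (fun n => nth z [:: x; y] n : A) e.1 = eval (fun n => nth z [:: x; y] n) e.2.
Proof. by move=> lt_i; apply/mA/List_In_nth. Qed.

Hypothesis ai : forall e, List.In e ai_basis -> List.In e s.

Local Notation "x [+] y" := (@add A x y) (at level 50, left associativity).
Local Notation "x [*] y" := (@mul A x y) (at level 40, left associativity).
Local Notation "x [<=] y" := (x [+] y = y) (at level 70, no associativity).

Lemma ai_law i x y z : i < size ai_basis ->
  let e := nth (Var 0, Var 0) ai_basis i in
  eval (fun n => nth z [:: x; y] n : A) e.1 = eval (fun n => nth z [:: x; y] n) e.2.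
Proof. by move=> lt_i; apply/mA/ai/List_In_nth. Qed.

Lemma addA_ai x y z : x [+] (y [+] z) = x [+] y [+] z.
Proof. exact: (@ai_law 0 x y z). Qed.

Lemma addC_ai x y : x [+] y = y [+] x.
Proof. exact: (@ai_law 1 x y x). Qed.

Lemma addxx_ai x : x [+] x = x.
Proof. exact: (@ai_law 2 x x x). Qed.

Lemma mulA_ai x y z : x [*] (y [*] z) = x [*] y [*] z.
Proof. exact: (@ai_law 3 x y z). Qed.

Lemma mulC_ai x y : x [*] y = y [*] x.
Proof. exact: (@ai_law 4 x y x). Qed.

Lemma mulDr_ai x y z : x [*] (y [+] z) = x [*] y [+] x [*] z.
Proof. exact: (@ai_law 5 x y z). Qed.

Lemma mulCA_ai x y z : x [*] (y [*] z) = y [*] (x [*] z).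
Proof. by rewrite !mulA_ai (mulC_ai x). Qed.

Lemma mulDl_ai x y z : (y [+] z) [*] x = y [*] x [+] z [*] x.
Proof. by rewrite mulC_ai mulDr_ai !(mulC_ai x). Qed.

Lemma ai_le_trans y x z : x [<=] y -> y [<=] z -> x [<=] z.
Proof. by move=> xy <-; rewrite addA_ai xy. Qed.

Lemma ai_le_anti x y : x [<=] y -> y [<=] x -> x = y.
Proof. by move=> xy yx; rewrite -xy addC_ai. Qed.

Lemma ai_le_addl x y : x [<=] x [+] y.
Proof. by rewrite addA_ai addxx_ai. Qed.

Lemma ai_le_addr x y : x [<=] y [+] x.
Proof. by rewrite (addC_ai y) ai_le_addl. Qed.

Lemma ai_add_le x y z : x [<=] z -> y [<=] z -> x [+] y [<=] z.
Proof. by move=> xz yz; rewrite -addA_ai yz. Qed.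

Lemma ai_le_mul2l x y z : y [<=] z -> x [*] y [<=] x [*] z.
Proof. by move=> yz; rewrite -mulDr_ai yz. Qed.

Lemma ai_le_mul2r x y z : y [<=] z -> y [*] x [<=] z [*] x.
Proof. by move=> yz; rewrite -mulDl_ai yz. Qed.

Variable v : nat -> A.

(* The value [v 0] on the empty word is junk: there is no unit. *)
Fixpoint wval (w : seq nat) : A :=
  match w with
  | [::] => v 0
  | x :: w' => if w' is [::] then v x else v x [*] wval w'
  end.

Lemma wval_cons x w : w != [::] -> wval (x :: w) = v x [*] wval w.
Proof. by case: w. Qed.

Lemma wval_cat w1 w2 : w1 != [::] -> w2 != [::] ->
  wval (w1 ++ w2) = wval w1 [*] wval w2.
Proof.
elim: w1 => // x [|y w1] IH _ w2n; first by rewrite [LHS]wval_cons.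
by rewrite [LHS]wval_cons // IH // mulA_ai -wval_cons.
Qed.

Lemma wval_le t w : w \in words t -> wval w [<=] eval v t.
Proof.
elim: t w => [n|t1 IH1 t2 IH2|t1 IH1 t2 IH2] w.
- by rewrite inE => /eqP-> /=; exact: addxx_ai.
- rewrite words_Add => /orP[/IH1|/IH2] h; apply: (ai_le_trans h).
    exact: ai_le_addl.
  exact: ai_le_addr.
case/words_MulP => w1 [w2 [m1 m2 ->]].
rewrite wval_cat ?(word_neq0 m1) ?(word_neq0 m2) //=.
exact: ai_le_trans (ai_le_mul2l _ (IH2 _ m2)) (ai_le_mul2r _ (IH1 _ m1)).
Qed.

(* Used with [f] a translation: the induction for products then turns each
   factor into a part of the translation. *)
Lemma mul_eval_le (f : A -> A) t U :
    (forall x y, f (x [+] y) = f x [+] f y) ->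
    (forall w, w \in words t -> f (wval w) [<=] U) ->
  f (eval v t) [<=] U.
Proof.
elim: t f => [n|t1 IH1 t2 IH2|t1 IH1 t2 IH2] f fD h /=.
- by apply: (h [:: n]); rewrite inE.
- rewrite fD; apply: ai_add_le; [apply: IH1|apply: IH2] => // w m;
    by apply: h; rewrite words_Add m ?orbT.
apply: (IH1 (fun x => f (x [*] eval v t2))) => [x y|w1 m1].
  by rewrite mulDl_ai fD.
apply: (IH2 (fun y => f (wval w1 [*] y))) => [x y|w2 m2].
  by rewrite mulDr_ai fD.
rewrite -wval_cat ?(word_neq0 m1) ?(word_neq0 m2) //.
by apply: h; exact: words_Mul.
Qed.

Lemma eval_le t U :
  (forall w, w \in words t -> wval w [<=] U) -> eval v t [<=] U.
Proof. by apply: (@mul_eval_le id). Qed.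

(** The action of words on an element [e]. Unlike [wval] it is meaningful on the empty word, so
    letters can be cancelled without a unit. *)
Fixpoint mulw (e : A) (w : seq nat) : A :=
  if w is x :: w' then v x [*] mulw e w' else e.

Lemma mulw_cat e w1 w2 : mulw e (w1 ++ w2) = mulw (mulw e w2) w1.
Proof. by elim: w1 => //= x w1 ->. Qed.

Lemma mulwE e w : w != [::] -> mulw e w = wval w [*] e.
Proof.
elim: w => // x [|y w] IH _; first by [].
by rewrite wval_cons // -mulA_ai -IH.
Qed.

Lemma mulw_rem e x w : x \in w -> mulw e w = v x [*] mulw e (rem x w).
Proof.
elim: w => //= y w IH; rewrite inE eq_sym.
by case: eqP => [-> //|_] /= /IH ->; rewrite mulCA_ai.
Qed.

Lemma mulM_mulw a e w : a [*] mulw e w = mulw (a [*] e) w.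
Proof. by elim: w => //= x w <-; rewrite mulCA_ai. Qed.

Lemma mulw_even e w : (forall x, x \in w -> v x [*] (v x [*] e) = e) ->
  (forall x, ~~ odd (count_mem x w)) -> mulw e w = e.
Proof.
have [n] := ubnP (size w); elim: n w => // n IH [|x w] //= lt sat even_w.
have x_w : x \in w.
  by have := even_w x; rewrite /= eqxx -has_pred1 has_count; case: count.
rewrite (mulw_rem _ x_w) mulM_mulw mulM_mulw sat ?mem_head //; apply: IH.
- by rewrite size_rem //; case: (w) x_w lt => //= *; lia.
- by move=> y /mem_rem y_w; apply: sat; rewrite inE y_w orbT.
move=> y; have := even_w y; rewrite count_rem x_w /=.
by case: eqP => [<-|]; rewrite ?add0n ?subn0 //; lia.
Qed.

(** First [w' ++ w'] is inserted next to [e], where it acts trivially; then [w ++ w'] has even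
    counts and cancels. *)
Lemma mulw_parity e w w' :
    (forall x, x \in w ++ w' -> v x [*] (v x [*] e) = e) ->
    (forall x, odd (count_mem x w) = odd (count_mem x w')) ->
  mulw e w = mulw e w'.
Proof.
move=> sat par.
have -> : mulw e w = mulw e (w ++ w' ++ w').
  rewrite mulw_cat (@mulw_even e (w' ++ w')) // => x.
    by rewrite mem_cat orbb => x_w'; apply: sat; rewrite mem_cat x_w' orbT.
  by rewrite count_cat oddD addbb.
rewrite catA mulw_cat; apply: mulw_even => [x /sat e_x|x].
  by rewrite !mulM_mulw e_x.
by rewrite count_cat oddD par addbb.
Qed.

End AdditivelyIdempotent.

Lemma satisfies_sym (A : algebra) u t : satisfies A (u, t) -> satisfies A (t, u).
Proof. by move=> e v; rewrite /= [LHS](esym (e v)). Qed.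

(** By antisymmetry and the symmetry of identities, completeness of a basis reduces to bounding one
    word of one side by the other side. *)
Lemma satisfies_of_le (A B : algebra) s e :
    is_model (fun e' => List.In e' s) B ->
    (forall e', List.In e' ai_basis -> List.In e' s) ->
    (forall u t, satisfies A (u, t) -> forall (v : nat -> B) w, w \in words t ->
       add (wval v w) (eval v u) = eval v u) ->
  satisfies A e -> satisfies B e.
Proof.
case: e => u t mB ai le_w e v /=.
by apply: (ai_le_anti mB ai); apply: (eval_le mB ai) => w;
  apply: le_w => //; exact: satisfies_sym.
Qed.

(** Evaluate at the indicator of the letters of [w]. *)
Lemma D_support u t w : satisfies D (u, t) -> w \in words t ->
  exists2 w', w' \in words u & {subset w' <= w}.
Proof.
move=> e w_t; have /hasP[w' w'_u /allP sub] : has (all (mem w)) (words u).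
  rewrite -[has _ _](evalD (mem w : nat -> D)).
  have /= -> := e (mem w : nat -> D); rewrite evalD; apply/hasP.
  by exists w => //; apply/allP.
by exists w'.
Qed.

Lemma D_basis_complete B e : is_model (fun e' => List.In e' D_basis) B ->
  satisfies D e -> satisfies B e.
Proof.
move=> mB; have ai e' : List.In e' ai_basis -> List.In e' D_basis by right; right.
have mulxx (x : B) : mul x x = x.
  exact: (@model_law _ _ mB 0 x x x).
have le_l (x y : B) : add (mul x y) x = x.
  by rewrite (addC_ai mB ai); exact: (@model_law _ _ mB 1 x y x).
have le_trans := ai_le_trans mB ai; have mulC := mulC_ai mB ai.
apply: (satisfies_of_le mB ai) => u t uDt v w w_t.
have val_le_var x : x \in w -> add (wval v w) (v x) = v x.
  elim: (w) => // y w' IH; case: (eqVneq w' [::]) => [->|w'n].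
    by rewrite inE => /eqP->; rewrite /= (addxx_ai mB ai).
  rewrite inE wval_cons // => /orP[/eqP->|/IH h]; first exact: le_l.
  by apply: (le_trans) h; rewrite mulC; exact: le_l.
have [w' w'_u sub] := D_support uDt w_t.
apply: (le_trans) (wval_le mB ai v w'_u).
move: (word_neq0 w'_u) sub; elim: w' {w'_u} => // x w' IH _ sub.
have x_w := val_le_var x (sub x (mem_head _ _)).
case: (eqVneq w' [::]) => [-> //|w'n]; rewrite wval_cons //.
have {IH} h := IH w'n (fun y y_w => sub y (mem_behead (s := x :: w') y_w)).
(* Idempotence supplies one copy of [w] for the letter [x] and another for the rest of [w']. *)
rewrite -{1}[wval v w]mulxx.
exact: (le_trans) (ai_le_mul2r mB ai _ x_w) (ai_le_mul2l mB ai _ h).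
Qed.

Theorem D_finitely_based : finitely_based D.
Proof. exact: finitely_based_of_basis D_model D_basis_complete. Qed.

Lemma hsum_indicator (P : pred nat) (a : H) w :
  hsum (fun x => if P x then a else H1) w = count P w * hval a.
Proof.
rewrite /hsum -sum1_count big_distrl [RHS]big_mkcond /=; apply: eq_bigr => x _.
by case: (P x); rewrite ?mul1n.
Qed.

(** With [Hinf] at [x] and [H1] elsewhere, one occurrence of [x] already gives weight 2. *)
Lemma H_content u t w x : satisfies H (u, t) -> w \in words t -> x \in w ->
  exists2 w', w' \in words u & x \in w'.
Proof.
move=> e w_t x_w.
have [||w' w'_u] := @evalH_transfer (fun y => if pred1 x y then Hinf else H1) _ _ w e.
- by [].
- by rewrite hsum_indicator muln2 -[1]/(0.*2.+1) ltn_Sdouble -has_count has_pred1.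
rewrite hsum_indicator => h; exists w' => //.
by rewrite -has_pred1 has_count; case: count h.
Qed.

(** With [Ha] on [P] and [H1] elsewhere, the weight of a word counts its letters in [P]. For a pair
    of letters, the word found in [u] may contain one of them twice instead of both. *)
Lemma H_pair u t w (P : pred nat) : satisfies H (u, t) -> w \in words t ->
  1 < count P w -> exists2 w', w' \in words u & 1 < count P w'.
Proof.
move=> e w_t lt.
have [||w' w'_u] := @evalH_transfer (fun y => if P y then Ha else H1) _ _ w e.
- by [].
- by rewrite hsum_indicator muln1.
by rewrite hsum_indicator muln1; exists w'.
Qed.

(** The law [mul3] breaks a word of [t] into its two-letter subwords, and each of these lies below
    [u] by [H_pair]. *)
Lemma H_basis_complete B e : is_model (fun e' => List.In e' H_basis) B ->
  satisfies H e -> satisfies B e.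
Proof.
move=> mB.
have ai e' : List.In e' ai_basis -> List.In e' H_basis by right; right; right.
have le_trans := ai_le_trans mB ai; have mulC := mulC_ai mB ai.
have mulA := mulA_ai mB ai.
have add_le := ai_add_le mB ai.
have le_l (x y : B) : add x (mul x y) = mul x y.
  exact: (@model_law _ _ mB 0 x y x).
have le_r (x y : B) : add x (mul y x) = mul y x by rewrite mulC le_l.
have mul3 (x y z : B) :
    mul x (mul y z) = add (add (mul x y) (mul y z)) (mul x z).
  exact: (@model_law _ _ mB 1 x y z).
have sqr_mul (x y : B) : mul (mul x x) y = add (mul x x) y.
  exact: (@model_law _ _ mB 2 x y x).
apply: (satisfies_of_le mB ai) => u t uHt v w w_t.
have wval_sub w1 w2 : subseq w1 w2 -> w1 != [::] ->
    add (wval v w1) (wval v w2) = wval v w2.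
  elim: w2 w1 => [|y w2 IH] [|x w1] // sub _; rewrite /= in sub.
  case: (eqVneq w2 [::]) sub => [-> /=|w2n sub].
    by case: (x =P y) => // -> /eqP ->; exact: (addxx_ai mB ai).
  rewrite (@wval_cons _ _ y w2) //; move: sub; case: (x =P y) => [->|_] sub.
    have [->|w1n] := eqVneq w1 [::]; first exact: le_l.
    by rewrite (@wval_cons _ _ y w1) //; apply: (ai_le_mul2l mB ai); exact: IH.
  by apply: (le_trans) (IH _ sub isT) _; exact: le_r.
have sub_le w1 w2 : subseq w1 w2 -> w1 != [::] -> w2 \in words u ->
    add (wval v w1) (eval v u) = eval v u.
  by move=> sub w1n w2_u; apply: (le_trans) (wval_sub _ _ sub w1n) (wval_le mB ai v w2_u).
have var_le x : x \in w -> add (v x) (eval v u) = eval v u.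
  case/(H_content uHt w_t) => w' w'_u x_w'.
  by apply: (sub_le [:: x] w'); rewrite ?sub1seq.
have pair_le x y : subseq [:: x; y] w -> add (mul (v x) (v y)) (eval v u) = eval v u.
  move=> sub; have [|w' w'_u] := @H_pair _ _ _ (mem [:: x; y]) uHt w_t.
    apply: leq_trans (leq_count_subseq (mem [:: x; y]) sub).
    by rewrite /= !inE !eqxx orbT.
  have xU := var_le x (mem_subseq sub (mem_head _ _)).
  have yU : add (v y) (eval v u) = eval v u.
    by apply/var_le/(mem_subseq sub); rewrite !inE eqxx orbT.
  rewrite -size_filter.
  have := filter_subseq (mem [:: x; y]) w'.
  have := filter_all (mem [:: x; y]) w'.
  case: [seq _ <- _ | _] => [|a [|b r]] //= /and3P[a_xy b_xy _] abr _.
  have ab : add (mul (v a) (v b)) (eval v u) = eval v u.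
    apply: (sub_le [:: a; b] w') => //; apply: subseq_trans abr.
    by rewrite /= !eqxx sub0seq.
  (* Handles a word of [u] with a repeated letter [p]: the product of [p] and [q] lies below
     [p * p * q], which is the sum of [p * p] and [q]. *)
  have sqr_le p q : add (mul (v p) (v p)) (eval v u) = eval v u ->
      add (v q) (eval v u) = eval v u ->
      add (mul (v p) (v q)) (eval v u) = eval v u.
    move=> ppU qU; apply: (@le_trans (mul (mul (v p) (v p)) (v q))).
      by rewrite -mulA; exact: le_r.
    by rewrite sqr_mul; exact: add_le.
  move: a_xy b_xy ab; rewrite !inE => /orP[] /eqP-> /orP[] /eqP->.
  - by move/sqr_le; apply.
  - by [].
  - by rewrite mulC.
  - by move/sqr_le => /(_ x xU); rewrite mulC.
move: (word_neq0 w_t) var_le pair_le => {w_t}.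
have [n] := ubnP (size w); elim: n w => // n IH [|x [|y w]] //= lt _ var_le pair_le.
  by apply: var_le; rewrite mem_head.
have xy : add (mul (v x) (v y)) (eval v u) = eval v u.
  by apply: pair_le; rewrite /= !eqxx sub0seq.
case: (eqVneq w [::]) => [-> //|wn].
have -> : (if w is [::] then v y else mul (v y) (wval v w)) = mul (v y) (wval v w).
  by case: (w) wn.
rewrite mul3; apply: (add_le); first apply: (add_le) => //.
- rewrite -(wval_cons v y wn); apply: IH => // [z z_w|a b sub].
    by apply: var_le; rewrite inE z_w orbT.
  by apply/pair_le/(@subseq_trans _ (y :: w) [:: a; b] [:: x, y & w] sub)/subseq_cons.
- rewrite -(wval_cons v x wn); apply: IH => // [z|a b sub].
    by rewrite inE => /orP[/eqP->|z_w]; apply: var_le; rewrite !inE ?eqxx ?z_w ?orbT.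
  apply/pair_le/(@subseq_trans _ (x :: w) [:: a; b] [:: x, y & w] sub).
  exact: (cat_subseq (subseq_refl [:: x]) (subseq_cons w y)).
Qed.

Theorem H_finitely_based : finitely_based H.
Proof. exact: finitely_based_of_basis H_model H_basis_complete. Qed.

(** * Affine spans over F_2 and the basis of [G] *)

Section ParityDuality.

Import GRing.Theory.
Local Open Scope ring_scope.

Lemma F2_odd (n : nat) : n%:R = (odd n)%:R :> 'F_2.
Proof.
rewrite -[in LHS](odd_double_half n) natrD -muln2 natrM.
by rewrite (_ : 2%:R = 0 :> 'F_2) ?mulr0 ?addr0 //; apply/val_inj.
Qed.

Lemma F2_bool_inj (a b : bool) : a%:R = b%:R :> 'F_2 -> a = b.
Proof. by case: a b => [] [] // /(congr1 val). Qed.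

Lemma F2_nat (k : 'F_2) : k = (k != 0)%:R.
Proof. by case: k => [[|[|]]] // lt; apply/val_inj. Qed.

(* Duality for affine subspaces over F_2: [b] is a linear functional whose
   constant value on the span of [us] is [c]. *)
Lemma parity_duality (us : seq (seq nat)) (w : seq nat) :
    (forall (b : pred nat) c, (forall u, u \in us -> odd (count b u) = c) ->
       odd (count b w) = c) ->
  exists ws, [/\ {subset ws <= us}, odd (size ws) &
    forall x, odd (count_mem x (flatten ws)) = odd (count_mem x w)].
Proof.
move=> sep.
have [n lt_n] : exists n, forall u x, u \in w :: us -> x \in u -> (x < n)%N.
  exists (\max_(x <- flatten (w :: us)) x).+1 => u x u_in x_u; rewrite ltnS.
  by apply: (@leq_bigmax_seq _ _ xpredT id) => //; apply/flattenP; exists u.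
(* Coordinate 0 is 1 on every word, so a linear combination equal to [vec w] has an odd number of
   terms. The letter [x] has coordinate [x.+1]. *)
pose vec (u : seq nat) : 'rV['F_2]_n.+1 :=
  delta_mx 0 ord0 + \sum_(x <- u) delta_mx 0 (inord x.+1).
have vec0 u : u \in w :: us -> vec u 0 ord0 = 1.
  move=> u_in; rewrite mxE mxE !eqxx summxE big1_seq ?addr0 // => x /= x_u.
  by rewrite mxE eqxx -val_eqE /= inordK ?ltnS ?(lt_n u).
have vecS u y : u \in w :: us -> (y < n)%N ->
    vec u 0 (inord y.+1) = (count_mem y u)%:R.
  move=> u_in lt_y; rewrite mxE mxE summxE eqxx -val_eqE /= inordK ?ltnS // add0r.
  rewrite -sum1_count natr_sum [RHS]big_mkcond /= !big_seq.
  apply: eq_bigr => x x_u; rewrite mxE eqxx -val_eqE /=.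
  by rewrite !inordK ?ltnS // ?(lt_n u) // eqSS eq_sym; case: eqP.
have vecM u (c : 'cV_n.+1) :
    (vec u *m c) 0 0 = c ord0 0 + \sum_(x <- u) c (inord x.+1) 0.
  rewrite mulmxDl mulmx_suml mxE summxE -rowE mxE; congr (_ + _).
  by apply: eq_bigr => x _; rewrite -rowE mxE.
pose M : 'M['F_2]_(size us, n.+1) := \matrix_(i < size us) vec (nth [::] us i).
(* If [vec w] were outside the row space of [M], some column [c] of the cokernel would not kill it.
   But [c] kills every row, so the predicate [b] read off from [c] has constant parity on [us], and
   [sep] extends this to [w]. *)
have [/submxP[d wE] | ] := boolP (vec w <= M)%MS; last first.
  rewrite submxE => /eqP; case; apply/rowP => j.
  pose c : 'cV_n.+1 := cokermx M *m delta_mx j 0.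
  pose b x := c (inord x.+1) 0 != 0.
  have vecb u : (vec u *m c) 0 0 = c ord0 0 + (odd (count b u))%:R.
    rewrite vecM -F2_odd -sum1_count natr_sum [in RHS]big_mkcond; congr (_ + _).
    by apply: eq_bigr => x _; rewrite [LHS]F2_nat -/(b x); case: (b x).
  have c0 : c ord0 0 + (odd (count b w))%:R = 0.
    rewrite (sep b (c ord0 0 != 0)) => [|u /(nthP [::])[i lt_i <-]].
      by rewrite -F2_nat -mulr2n -mulr_natl (F2_odd 2) mul0r.
    apply/F2_bool_inj; rewrite -F2_nat; apply: (addrI (c ord0 0)).
    rewrite -vecb -mulr2n -mulr_natl (F2_odd 2) mul0r.
    have -> : vec (nth [::] us i) = row (Ordinal lt_i) M by rewrite rowK.
    by rewrite mulmxA -row_mul mulmx_coker -colE !mxE.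
  by move: c0; rewrite -vecb mulmxA -colE mxE => ->; rewrite mxE.
pose ws := [seq nth [::] us i | i : 'I_(size us) <- enum 'I_(size us) & d 0 i != 0].
have big_ws (F : seq nat -> 'F_2) :
    \sum_(u <- ws) F u = \sum_i d 0 i * F (nth [::] us i).
  rewrite big_map big_filter big_mkcond big_enum /=; apply: eq_bigr => i _.
  by rewrite [d 0 i in RHS]F2_nat; case: eqP; rewrite ?mul0r ?mul1r.
have wEj j : vec w 0 j = \sum_i d 0 i * vec (nth [::] us i) 0 j.
  by rewrite wE mxE; apply: eq_bigr => i _; rewrite mxE.
have ws_us : {subset ws <= us}.
  by move=> u /mapP[i _ ->]; apply: mem_nth.
exists ws; split=> // [|x].
  apply/F2_bool_inj; rewrite -F2_odd -sum1_size natr_sum big_ws.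
  rewrite -[RHS](vec0 w) ?mem_head // wEj; apply: eq_bigr => i _.
  by rewrite vec0 // inE mem_nth ?orbT.
apply/F2_bool_inj; rewrite -!F2_odd.
have [lt_x|ge_x] := ltnP x n; last first.
  have no_x u : u \in w :: us -> count_mem x u = 0%N.
    by move=> u_in; apply/count_memPn/negP => /(lt_n _ _ u_in); rewrite ltnNge ge_x.
  rewrite (no_x w) ?mem_head // (count_memPn _) //; apply/flattenP.
  case=> u /ws_us u_us; apply/negP/count_memPn/no_x.
  by rewrite inE u_us orbT.
rewrite -(vecS w) ?mem_head // wEj count_flatten sumnE big_map natr_sum big_ws.
by apply: eq_bigr => i _; rewrite vecS // inE mem_nth ?orbT.
Qed.

End ParityDuality.

Lemma gprod_toG (b : pred nat) w :
  gprod (fun x => toG (b x)) w = toG (odd (count b w)).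
Proof.
rewrite /gprod; elim: w => [|x w IH]; first by rewrite big_nil.
by rewrite big_cons IH /= oddD; case: (b x) (odd _) => [] [].
Qed.

Lemma G_parity u t (b : pred nat) c : satisfies G (u, t) ->
  (forall w, w \in words u -> odd (count b w) = c) ->
  forall w, w \in words t -> odd (count b w) = c.
Proof.
move=> e h w w_t; have toG_inj : injective toG by do 2!case.
have /evalG/(_ w w_t) : eval (fun x => toG (b x) : G) t = toG c.
  by rewrite -[LHS](e _); apply/evalG => w' /h; rewrite gprod_toG => ->.
by rewrite gprod_toG => /toG_inj.
Qed.

Lemma gprod_finite v w c x : gprod v w = toG c -> x \in w -> v x <> Ginf.
Proof.
move=> e x_w vx; move: e; rewrite /gprod (big_rem x) //= vx.
by case: (\big[_/_]_(_ <- _) _) c => [] [].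
Qed.

(** With [Ginf] at [x] and [G1] elsewhere, a term is finite exactly when [x] does not occur in
    it. *)
Lemma G_content u t w x : satisfies G (u, t) -> w \in words t -> x \in w ->
  x \in flatten (words u).
Proof.
move=> e w_t x_w; apply/negPn/negP => x_u.
pose v y : G := if y == x then Ginf else G1.
have /evalG/(_ w w_t)/gprod_finite/(_ x_w) : eval v t = toG false.
  rewrite -[LHS](e v); apply/evalG => w' w'_u.
  rewrite /gprod big1_seq // => y /= y_w'; rewrite /v; case: eqP => // yx.
  by case/negP: x_u; apply/flattenP; exists w'; rewrite -?yx.
by rewrite /v eqxx.
Qed.

(** Modulo squares of variables, a word of [t] is a product of an odd number of words of [u], and
    such products lie below [u] by the second law. The squares are harmless because they fix the
    values of both sides. *)
Lemma G_basis_complete B e : is_model (fun e' => List.In e' G_basis) B ->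
  satisfies G e -> satisfies B e.
Proof.
move=> mB.
have ai e' : List.In e' ai_basis -> List.In e' G_basis by right; right; right.
have le_trans := ai_le_trans mB ai; have mulC := mulC_ai mB ai.
have addC := addC_ai mB ai; have mulA := mulA_ai mB ai.
have mulCA := mulCA_ai mB ai; have add_le := ai_add_le mB ai.
have cube (x : B) : mul x (mul x x) = x by exact: (@model_law _ _ mB 0 x x x).
have mul3_le (x y z U : B) : add x U = U -> add y U = U -> add z U = U ->
    add (mul x (mul y z)) U = U.
  move=> xU yU zU; apply: (@le_trans (add (add x y) z)).
    exact: (@model_law _ _ mB 1 x y z).
  by apply: (add_le) => //; apply: (add_le).
have sqr_add (x y : B) : mul (mul x x) (mul (mul y y) (add x y)) = add x y.
  exact: (@model_law _ _ mB 2 x y x).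
apply: (satisfies_of_le mB ai) => u t uGt v w w_t.
have eval_sat s x : x \in flatten (words s) ->
    mul (v x) (mul (v x) (eval v s)) = eval v s.
  elim: s => [n|s1 IH1 s2 IH2|s1 IH1 s2 IH2] /= x_s.
  - by move: x_s; rewrite inE => /eqP->; exact: cube.
  (* If the square of [v x] fixes [p], it can be absorbed into the factor [p * p] that the third law
     supplies in front of the sum. *)
  - have sat_sum p q : mul (v x) (mul (v x) p) = p ->
        mul (v x) (mul (v x) (add p q)) = add p q.
      move=> p_x; rewrite -{1}(sqr_add p q) -[mul (mul p p) _]mulA.
      by rewrite mulA mulA -[mul (mul (v x) (v x)) p]mulA p_x mulA sqr_add.
    move: x_s; rewrite flatten_cat mem_cat => /orP[/IH1|/IH2]; first exact: sat_sum.
    by rewrite (addC (eval v s1)); exact: sat_sum.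
  case/flattenP: x_s => r /words_MulP[w1 [w2 [m1 m2 ->]]].
  rewrite mem_cat => /orP[x_w|x_w].
    by rewrite !mulA -[mul (mul _ _) (eval v s1)]mulA IH1 //; apply/flattenP; exists w1.
  rewrite !(mulCA (v x) (eval v s1)) IH2 //; apply/flattenP; exists w2 => //.
pose vars := flatten (words u).
have varsn : vars != [::].
  rewrite /vars; have [[|x r] r_u] := words_nonempty u; first by have := word_neq0 r_u.
  apply: contraTneq (mem_head x r) => vars0; apply/negP => x_r.
  suff : x \in vars by rewrite /vars vars0.
  by apply/flattenP; exists (x :: r).
(* [E] replaces the missing unit: it fixes the values of [u] and [t], and it is itself fixed by the
   square of every variable, so letters next to it cancel in pairs. *)
pose E := mul (wval v vars) (wval v vars).
have EsatP y : (forall x, x \in vars -> mul (v x) (mul (v x) y) = y) -> mul E y = y.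
  move=> sat; rewrite /E -mulA -!(mulwE mB ai) // -mulw_cat.
  apply: (mulw_even mB ai) => x; last by rewrite count_cat oddD addbb.
  by rewrite mem_cat orbb => /sat.
have Esat x : x \in vars -> mul (v x) (mul (v x) E) = E.
  move=> x_vars; rewrite /E -(mulwE mB ai) // (mulw_rem mB ai v _ x_vars).
  by rewrite !mulA -[mul (mul _ _) (v x)]mulA cube.
have content r x : r \in words t -> x \in r -> x \in vars.
  exact: G_content uGt.
have content' r x : r \in words u -> x \in r -> x \in flatten (words t).
  exact/G_content/satisfies_sym.
have Et : mul E (eval v t) = eval v t.
  apply: EsatP => x /flattenP[r r_u x_r]; apply: eval_sat.
  exact: content' r_u x_r.
apply: (le_trans) (wval_le mB ai v w_t) _; rewrite -Et.
apply: (mul_eval_le mB ai (f := mul E)) => [x y|{w_t}w w_t].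
  exact: (mulDr_ai mB ai).
have [|ws [ws_u odd_ws par]] := @parity_duality (words u) w.
  by move=> b c h; apply: G_parity uGt h w w_t.
have flat_n : flatten ws != [::].
  case: ws ws_u odd_ws {par} => // r ws ws_u _ /=.
  by have := word_neq0 (ws_u r (mem_head _ _)); case: r {ws_u}.
have flat_vars x : x \in flatten ws -> x \in vars.
  by case/flattenP=> r /ws_u r_u x_r; apply/flattenP; exists r.
have -> : mul E (wval v w) = mul E (wval v (flatten ws)).
  rewrite !(mulC E) -!(mulwE mB ai) ?(word_neq0 w_t) //; apply: (mulw_parity mB ai) => x.
    by rewrite mem_cat => /orP[/content|/flat_vars] h; apply: Esat => //; exact: h.
  exact/esym/par.
have <- : mul E (eval v u) = eval v u by apply: EsatP; exact: eval_sat.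
apply: (ai_le_mul2l mB ai).
have ws_le r : r \in ws -> add (wval v r) (eval v u) = eval v u.
  by move/ws_u; exact: (wval_le mB ai).
have ws_n r : r \in ws -> r != [::] by move/ws_u; exact: word_neq0.
move: odd_ws ws_le ws_n {ws_u par flat_n flat_vars}.
(* Each round absorbs two words through [mul3_le], which keeps the number of words odd. *)
have [n] := ubnP (size ws); elim: n ws => // n IH [|p [|q ws]] //= lt odd_ws ws_le ws_n.
  by rewrite cats0; apply: ws_le; rewrite mem_head.
have [ws0|wsn] := eqVneq ws [::]; first by rewrite ws0 in odd_ws.
have flat_n : flatten ws != [::].
  case: ws wsn ws_n {lt odd_ws ws_le} => // r ws _ /(_ r).
  by rewrite !inE eqxx !orbT; case: r => //= /(_ isT).
have p_n : p != [::] by apply: ws_n; rewrite mem_head.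
have q_n : q != [::] by apply: ws_n; rewrite !inE eqxx orbT.
have qws_n : q ++ flatten ws != [::] by case: (q) q_n.
rewrite !(wval_cat mB ai) //.
apply: mul3_le; [| |apply: IH => [||r r_ws|r r_ws]].
- by apply: ws_le; rewrite mem_head.
- by apply: ws_le; rewrite !inE eqxx orbT.
- exact: leq_trans (leqnSn _) lt.
- by rewrite negbK in odd_ws.
- by apply: ws_le; rewrite !inE r_ws !orbT.
- by apply: ws_n; rewrite !inE r_ws !orbT.
Qed.

Theorem G_finitely_based : finitely_based G.
Proof. exact: finitely_based_of_basis G_model G_basis_complete. Qed.

(** * The semiring of set families *)

Lemma disjoint_setU (T : finType) (A B C : {set T}) :
  [disjoint A :|: B & C] = [disjoint A & C] && [disjoint B & C].
Proof. by rewrite -!setI_eq0 setIUl setU_eq0. Qed.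

Lemma disjoint_setUI (T : finType) (p A B : {set T}) :
  [disjoint p & A] -> [disjoint p & B] -> p :|: A = p :|: B -> A = B.
Proof.
have setUKD (C : {set T}) : [disjoint p & C] -> (p :|: C) :\: p = C.
  by move=> dis; rewrite setDUl setDv set0U; apply/setDidPl; rewrite disjoint_sym.
by move=> /setUKD {2}<- /setUKD {2}<- ->.
Qed.

(** In a word without repetitions the doubled-letter alternative left open by [H_pair]
    disappears. *)
Lemma count_pair (T : eqType) (x y : T) (w : seq T) :
  uniq w -> 1 < count (mem [:: x; y]) w -> [/\ x \in w, y \in w & x != y].
Proof.
rewrite -size_filter => uw lt; have uf := filter_uniq (mem [:: x; y]) uw.
have one z : {subset [seq i <- w | mem [:: x; y] i] <= [:: z]} -> false.
  by move/(uniq_leq_size uf)=> /(leq_trans lt).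
split.
- apply/negPn/negP => x_w; suff /one : {subset [seq i <- w | mem [:: x; y] i] <= [:: y]} by [].
  move=> z; rewrite mem_filter !inE => /andP[/orP[/eqP->|//] x_w'].
  by rewrite x_w' in x_w.
- apply/negPn/negP => y_w; suff /one : {subset [seq i <- w | mem [:: x; y] i] <= [:: x]} by [].
  move=> z; rewrite mem_filter !inE => /andP[/orP[//|/eqP->] y_w'].
  by rewrite y_w' in y_w.
apply/eqP => xy; suff /one : {subset [seq i <- w | mem [:: x; y] i] <= [:: x]} by [].
by move=> z; rewrite mem_filter xy !inE orbb => /andP[].
Qed.

(** The hypothesis has the form that [H_pair] delivers; its case [x = y] covers repeated letters. *)
Lemma pairwise_of_count (r : rel nat) w :
  (forall x y, 1 < count (mem [:: x; y]) w -> r x y) -> pairwise r w.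
Proof.
elim: w => //= x w IH h; apply/andP; split.
  apply/allP => y y_w; apply: h; rewrite !inE eqxx add1n ltnS -has_count.
  by apply/hasP; exists y; rewrite ?inE ?eqxx ?orbT.
by apply: IH => y z lt; apply: h; apply: leq_trans lt (leq_addl _ _).
Qed.

Section Realizations.

Variables (V : finType) (F : {set {set V}}).

Definition extensible (S : {set {set V}}) : bool :=
  [&& S != set0, set0 \notin S &
   [exists p : {set V}, [forall s in S, [disjoint p & s] && (p :|: s \in F)]]].

Lemma extensibleP (S : {set {set V}}) :
  reflect [/\ S != set0, forall s, s \in S -> s != set0 &
           exists p : {set V}, forall s, s \in S -> [disjoint p & s] /\ p :|: s \in F]
          (extensible S).
Proof.
apply: (iffP and3P) => -[Sn S0 ext]; split=> //.
- by move=> s s_S; apply: contraNneq S0 => <-.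
- case/existsP: ext => p /forall_inP p_S; exists p => s /p_S /andP[]; by split.
- by apply/negP => /S0; rewrite eqxx.
case: ext => p p_S; apply/existsP; exists p; apply/forall_inP => s /p_S[-> ->].
by [].
Qed.

Definition normalize (S : {set {set V}}) := if extensible S then S else set0.

Definition family := {S : {set {set V}} | (S == set0) || extensible S}.

Lemma normalize_subproof S : (normalize S == set0) || extensible (normalize S).
Proof. by rewrite /normalize; case: ifP; rewrite ?eqxx // => ->; rewrite orbT. Qed.

Definition to_family S : family := exist _ (normalize S) (normalize_subproof S).

(** As the class of the ideal, [set0] has to absorb, while it is neutral for unions; hence the
    test. *)
Definition family_add (S T : family) : family :=
  to_family (if (sval S == set0) || (sval T == set0) then set0 else sval S :|: sval T).

Definition family_mul (S T : family) : family :=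
  to_family (if [forall s in sval S, forall t in sval T, [disjoint s & t]]
             then [set s :|: t | s in sval S, t in sval T] else set0).

(* The Rees quotient of the semiring of nonempty families of nonempty sets,
   multiplied by disjoint union, by the ideal of the families that no
   translation sends into [F]; the class of this ideal is encoded by [set0]. *)
Definition family_algebra : algebra :=
  Algebra family_add family_mul (inhabits (to_family set0)).

Lemma val_to_family S : sval (to_family S) != set0 ->
  extensible S /\ sval (to_family S) = S.
Proof. by rewrite /= /normalize; case: ifP; rewrite ?eqxx. Qed.

Lemma extensible_to_family S : extensible S -> sval (to_family S) = S.
Proof. by rewrite /= /normalize => ->. Qed.

Lemma family_extensible (S : family) : sval S != set0 -> extensible (sval S).
Proof. by have := svalP S; case: eqP. Qed.

Lemma family_add_neq0 (S T : family) : sval (family_add S T) != set0 ->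
  [/\ sval S != set0, sval T != set0 & sval (family_add S T) = sval S :|: sval T].
Proof.
rewrite /family_add; case: ifP => [_ /val_to_family[/extensibleP[]]|].
  by rewrite eqxx.
by move/negbT; rewrite negb_or => /andP[-> ->] /val_to_family[_ ->].
Qed.

Lemma family_mul_neq0 (S T : family) : sval (family_mul S T) != set0 ->
  [/\ sval S != set0, sval T != set0,
      forall s t, s \in sval S -> t \in sval T -> [disjoint s & t] &
      sval (family_mul S T) = [set s :|: t | s in sval S, t in sval T]].
Proof.
rewrite /family_mul; case: ifP => [disj|_] /val_to_family[/extensibleP[ST0 _ _]].
  move=> ->; case/set0Pn: ST0 => r /imset2P[s t s_S t_T _]; split=> //.
  - by apply/set0Pn; exists s.
  - by apply/set0Pn; exists t.
  by move=> s' t' s'_S t'_T; apply: (forall_inP (forall_inP disj s' s'_S)).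
by rewrite eqxx in ST0.
Qed.

Lemma family_elt_neq0 (S : family) s : s \in sval S -> s != set0.
Proof.
move=> s_S; have /family_extensible/extensibleP[_ n0 _] : sval S != set0.
  by apply/set0Pn; exists s.
exact: n0.
Qed.

(** * Values of terms as sets of realizations *)

Section Valuation.

Variable v : nat -> family_algebra.

Definition selects (f : nat -> {set V}) (w : seq nat) : Prop :=
  forall x, x \in w -> f x \in sval (v x).

Definition join (f : nat -> {set V}) (w : seq nat) : {set V} :=
  \bigcup_(x <- w) f x.

Definition disj (f : nat -> {set V}) : rel nat := fun x y => [disjoint f x & f y].

Lemma join_cat (f : nat -> {set V}) (w1 w2 : seq nat) : join f (w1 ++ w2) = join f w1 :|: join f w2.
Proof. exact: big_cat. Qed.

Lemma joinP (f : nat -> {set V}) (w : seq nat) (a : V) :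
  reflect (exists2 x, x \in w & a \in f x) (a \in join f w).
Proof.
suff -> : (a \in join f w) = has (fun x => a \in f x) w by exact: hasP.
by rewrite /join; elim: w => [|x w IH]; rewrite ?big_nil ?big_cons inE // IH.
Qed.

Lemma sub_join (f : nat -> {set V}) (w : seq nat) x : x \in w -> f x \subset join f w.
Proof. by move=> x_w; apply/subsetP => a a_x; apply/joinP; exists x. Qed.

Lemma eq_join (f g : nat -> {set V}) (w : seq nat) : {in w, f =1 g} -> join f w = join g w.
Proof. by move=> fg; rewrite /join !big_seq; apply: eq_bigr. Qed.

Lemma disjoint_joinP (p : {set V}) (f : nat -> {set V}) (w : seq nat) :
  reflect (forall x, x \in w -> [disjoint p & f x]) [disjoint p & join f w].
Proof.
apply: (iffP idP) => [dis x x_w|dis].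
  exact: disjointWr (sub_join f x_w) dis.
rewrite disjoint_sym disjoint_subset; apply/subsetP => a /joinP[x x_w a_x].
by rewrite inE (disjointFl (dis x x_w) a_x).
Qed.

Lemma allrel_disj (f : nat -> {set V}) (w1 w2 : seq nat) :
  allrel (disj f) w1 w2 = [disjoint join f w1 & join f w2].
Proof.
apply/allrelP/disjoint_joinP => [dis y y_w|dis x y x_w y_w].
  by rewrite disjoint_sym; apply/disjoint_joinP => x x_w; rewrite disjoint_sym; apply: dis.
exact: disjointWl (sub_join f x_w) (dis y y_w).
Qed.

Lemma selects_catP f w1 w2 : selects f (w1 ++ w2) <-> selects f w1 /\ selects f w2.
Proof.
split=> [sel|[sel1 sel2] x].
  by split=> x x_w; apply: sel; rewrite mem_cat x_w ?orbT.
by rewrite mem_cat => /orP[/sel1|/sel2].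
Qed.

Lemma selects_exists w : (forall x, x \in w -> sval (v x) != set0) ->
  exists f, selects f w.
Proof.
move=> n0; exists (fun x => odflt set0 [pick s in sval (v x)]) => x /n0 /set0Pn[s s_v].
by case: pickP => //= /(_ s); rewrite s_v.
Qed.

Lemma eq_pairwise_disj (f g : nat -> {set V}) (w : seq nat) :
  {in w, f =1 g} -> pairwise (disj f) w = pairwise (disj g) w.
Proof.
move=> fg; pose r := [rel s t : {set V} | [disjoint s & t]].
have mapE h : pairwise (disj h) w = pairwise r (map h w) by rewrite pairwise_map.
by rewrite !mapE; congr pairwise; exact/eq_in_map.
Qed.

Lemma selects_glue f1 f2 w1 w2 : selects f1 w1 -> selects f2 w2 ->
    (forall x, x \in w1 -> x \notin w2) ->
  exists f, [/\ selects f (w1 ++ w2), {in w1, f =1 f1} & {in w2, f =1 f2}].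
Proof.
move=> sel1 sel2 dis; pose f x := if x \in w1 then f1 x else f2 x.
have f_w1 : {in w1, f =1 f1} by move=> x x_w1; rewrite /f x_w1.
have f_w2 : {in w2, f =1 f2}.
  by move=> x x_w2; rewrite /f ifN //; apply: contraL x_w2; exact: dis.
exists f; split=> //.
by apply/selects_catP; split=> x x_w; [rewrite f_w1 ?sel1 | rewrite f_w2 ?sel2].
Qed.

Lemma eval_Add_neq0 t1 t2 : sval (eval v (Add t1 t2)) != set0 ->
  [/\ sval (eval v t1) != set0, sval (eval v t2) != set0 &
      sval (eval v (Add t1 t2)) = sval (eval v t1) :|: sval (eval v t2)].
Proof. exact: family_add_neq0. Qed.

Lemma eval_Mul_neq0 t1 t2 : sval (eval v (Mul t1 t2)) != set0 ->
  [/\ sval (eval v t1) != set0, sval (eval v t2) != set0,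
      forall s t, s \in sval (eval v t1) -> t \in sval (eval v t2) ->
        [disjoint s & t] &
      sval (eval v (Mul t1 t2)) =
        [set s :|: t | s in sval (eval v t1), t in sval (eval v t2)]].
Proof. exact: family_mul_neq0. Qed.

Lemma eval_vars_neq0 t : sval (eval v t) != set0 ->
  forall w x, w \in words t -> x \in w -> sval (v x) != set0.
Proof.
elim: t => [n|t1 IH1 t2 IH2|t1 IH1 t2 IH2].
- by move=> n0 w x; rewrite inE => /eqP->; rewrite inE => /eqP->.
- case/eval_Add_neq0 => /IH1 h1 /IH2 h2 _ w x.
  by rewrite mem_cat => /orP[/h1|/h2]; apply.
case/eval_Mul_neq0 => /IH1 h1 /IH2 h2 _ _ w x.
case/words_MulP => w1 [w2 [/h1 g1 /h2 g2 ->]].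
by rewrite mem_cat => /orP[/g1|/g2].
Qed.

Lemma realize_in_eval t w f : sval (eval v t) != set0 -> w \in words t ->
  selects f w -> pairwise (disj f) w /\ join f w \in sval (eval v t).
Proof.
elim: t w => [n|t1 IH1 t2 IH2|t1 IH1 t2 IH2] w.
- by rewrite inE => _ /eqP-> sel; rewrite /join big_seq1 sel ?mem_head.
- case/eval_Add_neq0 => n1 n2 ->; rewrite mem_cat inE.
  by case/orP => [/(IH1 _ n1) h|/(IH2 _ n2) h] /h[-> ->]; rewrite ?orbT.
case/eval_Mul_neq0 => n1 n2 dis -> /words_MulP[w1 [w2 [m1 m2 ->]]].
case/selects_catP => /(IH1 _ n1 m1)[p1 j1] /(IH2 _ n2 m2)[p2 j2].
rewrite pairwise_cat p1 p2 allrel_disj dis // join_cat; split=> //.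
by apply/imset2P; exists (join f w1) (join f w2).
Qed.

(** A shared letter would have a value disjoint from itself, hence empty. *)
Lemma disjoint_words w1 w2 f : pairwise (disj f) (w1 ++ w2) ->
  selects f (w1 ++ w2) -> forall x, x \in w1 -> x \notin w2.
Proof.
rewrite pairwise_cat => /and3P[/allrelP dis _ _] sel x x_w1; apply/negP => x_w2.
have := dis x x x_w1 x_w2; rewrite /disj -setI_eq0 setIid.
by apply/negP/family_elt_neq0/sel; rewrite mem_cat x_w1.
Qed.

Lemma pairwise_disj_uniq f w : selects f w -> pairwise (disj f) w -> uniq w.
Proof.
elim: w => //= x w IH sel /andP[/allP x_w pw].
rewrite IH // => [|y y_w]; last by apply: sel; rewrite inE y_w orbT.
rewrite andbT; apply/negP => /x_w; rewrite /disj -setI_eq0 setIid.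
by apply/negP; apply: (family_elt_neq0 (sel x (mem_head _ _))).
Qed.

Lemma pairwise_disj_mem (f : nat -> {set V}) (w : seq nat) x y :
  pairwise (disj f) w -> x \in w -> y \in w -> x != y -> [disjoint f x & f y].
Proof.
elim: w => //= z w IH /andP[/allP z_w pw]; rewrite !inE.
move=> /orP[/eqP->|xw] /orP[/eqP->|yw]; rewrite ?eqxx //.
- by move=> _; exact: z_w.
- by move=> _; rewrite disjoint_sym; exact: z_w.
exact: IH.
Qed.

(** Converse of [realize_in_eval]. For a product, the two selections can be glued because a nonzero
    value forbids common letters. *)
Lemma eval_realized t s : s \in sval (eval v t) ->
  exists w f, [/\ w \in words t, selects f w & s = join f w].
Proof.
elim: t s => [n|t1 IH1 t2 IH2|t1 IH1 t2 IH2] s s_t.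
- exists [:: n], (fun=> s); rewrite /join big_seq1 inE; split=> // x.
  by rewrite inE => /eqP->.
- have /eval_Add_neq0[_ _ e] : sval (eval v (Add t1 t2)) != set0.
    by apply/set0Pn; exists s.
  move: s_t; rewrite e inE.
  case/orP => [/IH1|/IH2] [w [f [w_t sel s_w]]]; exists w, f;
    by rewrite words_Add w_t ?orbT.
have t_n0 : sval (eval v (Mul t1 t2)) != set0 by apply/set0Pn; exists s.
have /eval_Mul_neq0[n1 n2 _ e] := t_n0.
move: s_t; rewrite e => /imset2P[s1 s2 /IH1[w1 [f1 [m1 sel1 ->]]]].
case/IH2=> w2 [f2 [m2 sel2 ->]] ->.
have [|g sel] := @selects_exists (w1 ++ w2).
  by move=> x; apply: eval_vars_neq0 t_n0 _ _ _; exact: words_Mul.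
have [pw _] := realize_in_eval t_n0 (words_Mul m1 m2) sel.
have [f [sel_f f1E f2E]] := selects_glue sel1 sel2 (disjoint_words pw sel).
rewrite -(eq_join f1E) -(eq_join f2E).
by exists (w1 ++ w2), f; rewrite words_Mul // join_cat.
Qed.

(** For one factor of a product the translation [p] is enlarged by a realization of the other
    factor, so the induction runs over all [p]. *)
Lemma eval_neq0 t (p : {set V}) :
    (forall w x, w \in words t -> x \in w -> sval (v x) != set0) ->
    (forall w f, w \in words t -> selects f w ->
       [/\ pairwise (disj f) w, [disjoint p & join f w] & p :|: join f w \in F]) ->
  sval (eval v t) != set0.
Proof.
elim: t p => [n|t1 IH1 t2 IH2|t1 IH1 t2 IH2] p n0 real.
- by apply: (n0 [:: n]); rewrite inE.
- have n1 : sval (eval v t1) != set0.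
    apply: (IH1 p) => [w x w_t|w f w_t]; [apply: n0 | apply: real];
      by rewrite words_Add w_t.
  have n2 : sval (eval v t2) != set0.
    apply: (IH2 p) => [w x w_t|w f w_t]; [apply: n0 | apply: real];
      by rewrite words_Add w_t orbT.
  rewrite [eval v _]/= /family_add (negPf n1) (negPf n2) extensible_to_family.
    by rewrite setU_eq0 (negPf n1).
  apply/extensibleP; split; first by rewrite setU_eq0 (negPf n1).
    by move=> s; rewrite inE => /orP[]; exact: family_elt_neq0.
  exists p => s; rewrite inE => /orP[] /eval_realized[w [f [w_t sel ->]]];
    by case: (real w f) => //; rewrite words_Add w_t ?orbT.
have disw w1 w2 x : w1 \in words t1 -> w2 \in words t2 -> x \in w1 -> x \notin w2.
  move=> m1 m2; have m := words_Mul m1 m2.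
  have [|g sel] := @selects_exists (w1 ++ w2); first by move=> y; apply: n0.
  by have [pw _ _] := real _ _ m sel; apply: disjoint_words pw sel x.
have real2 w1 w2 f1 f2 : w1 \in words t1 -> w2 \in words t2 ->
    selects f1 w1 -> selects f2 w2 ->
  [/\ pairwise (disj f1) w1, pairwise (disj f2) w2,
      [disjoint join f1 w1 & join f2 w2],
      [disjoint p & join f1 w1 :|: join f2 w2] &
      p :|: (join f1 w1 :|: join f2 w2) \in F].
  move=> m1 m2 sel1 sel2.
  have [f [sel f1E f2E]] := selects_glue sel1 sel2 (fun x => disw w1 w2 x m1 m2).
  have [] := real _ _ (words_Mul m1 m2) sel.
  rewrite pairwise_cat allrel_disj join_cat (eq_join f1E) (eq_join f2E).
  by rewrite (eq_pairwise_disj f1E) (eq_pairwise_disj f2E) => /and3P[].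
have [[u1 mu1] [u2 mu2]] := (words_nonempty t1, words_nonempty t2).
have n01 w x : w \in words t1 -> x \in w -> sval (v x) != set0.
  by move=> m x_w; apply: (n0 (w ++ u2)); rewrite ?words_Mul // mem_cat x_w.
have n02 w x : w \in words t2 -> x \in w -> sval (v x) != set0.
  by move=> m x_w; apply: (n0 (u1 ++ w)); rewrite ?words_Mul // mem_cat x_w orbT.
have [g1 sel1] := selects_exists (fun x => n01 u1 x mu1).
have [g2 sel2] := selects_exists (fun x => n02 u2 x mu2).
have n1 : sval (eval v t1) != set0.
  apply: (IH1 (p :|: join g2 u2)) => // w f m sel.
  have [-> _ d12 dp pF] := real2 _ _ _ _ m mu2 sel sel2.
  split=> //; last by rewrite -setUA [join g2 u2 :|: _]setUC.
  move: dp; rewrite disjoint_sym disjoint_setU => /andP[dp _].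
  by rewrite disjoint_setU disjoint_sym dp disjoint_sym d12.
have n2 : sval (eval v t2) != set0.
  apply: (IH2 (p :|: join g1 u1)) => // w f m sel.
  have [_ -> d12 dp pF] := real2 _ _ _ _ mu1 m sel1 sel.
  split=> //; last by rewrite -setUA.
  move: dp; rewrite disjoint_sym disjoint_setU => /andP[_ dp].
  by rewrite disjoint_setU disjoint_sym dp d12.
have dis s1 s2 : s1 \in sval (eval v t1) -> s2 \in sval (eval v t2) ->
    [/\ [disjoint s1 & s2], [disjoint p & s1 :|: s2] & p :|: (s1 :|: s2) \in F].
  case/eval_realized => w1 [f1 [m1 {}sel1 ->]].
  case/eval_realized => w2 [f2 [m2 {}sel2 ->]].
  by have [] := real2 _ _ _ _ m1 m2 sel1 sel2.
have [s1 s1_t] := set0Pn _ n1; have [s2 s2_t] := set0Pn _ n2.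
rewrite [eval v _]/= /family_mul ifT; last first.
  by apply/forall_inP => a a_t; apply/forall_inP => b b_t; case: (dis a b).
have ne : [set s :|: t | s in sval (eval v t1), t in sval (eval v t2)] != set0.
  by apply/set0Pn; exists (s1 :|: s2); apply/imset2P; exists s1 s2.
rewrite extensible_to_family //; apply/extensibleP; split=> //.
  move=> _ /imset2P[a b a_t _ ->]; rewrite setU_eq0 negb_and.
  by rewrite (family_elt_neq0 a_t).
by exists p => _ /imset2P[a b a_t b_t ->]; case: (dis a b).
Qed.

End Valuation.

End Realizations.

(** * The configuration F and the set T *)

Section Configuration.

Variable k : nat.
Hypothesis k_gt0 : 0 < k.

Let n := k.*2.+2.
Let V : finType := ('I_n + 'I_n * 'I_n)%type.

Implicit Types (i j l : 'I_n) (s e C X : {set V}).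

(* The private variable [inr (i, j)] makes [edge i j] maximal among the sets in
   which any two elements lie in a common member of [config]. The diagonal is
   the only other member containing some [inr (i, i)]; it creates the relation
   [top = diagonal + \sum_i edge i i] modulo 2, which has an odd number of terms
   on the right because [n] is even. *)
Definition edge i j : {set V} := [set inl i; inl j; inr (i, j)].
Definition seed : {set V} := [set inl ord0].
Definition diagonal : {set V} := [set inr (i, i) | i : 'I_n].
Definition top : {set V} := [set inl i | i : 'I_n].

Definition config : {set {set V}} :=
  [set seed; diagonal] :|: [set edge ij.1 ij.2 | ij : 'I_n * 'I_n].

Lemma in_config e : e \in config ->
  [\/ e = seed, e = diagonal | exists i j, e = edge i j].
Proof.
rewrite !inE => /orP[/orP[]/eqP->|/imsetP[[i j] _ ->]].
- by constructor 1.
- by constructor 2.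
by constructor 3; exists i, j.
Qed.

Lemma seed_config : seed \in config. Proof. by rewrite !inE eqxx. Qed.
Lemma diagonal_config : diagonal \in config. Proof. by rewrite !inE eqxx orbT. Qed.
Lemma edge_config i j : edge i j \in config.
Proof. by rewrite inE; apply/orP; right; apply/imsetP; exists (i, j). Qed.

Lemma inl_edge l i j : (inl l \in edge i j) = (l == i) || (l == j).
Proof. by rewrite !inE orbF. Qed.

Lemma inr_edge l l' i j : (inr (l, l') \in edge i j) = (l == i) && (l' == j).
Proof. by rewrite !inE. Qed.

Lemma inl_diagonal l : inl l \in diagonal = false.
Proof. by apply/imsetP => -[]. Qed.

Lemma inr_diagonal i j : (inr (i, j) \in diagonal) = (i == j).
Proof. by apply/imsetP/eqP => [[l _ [-> ->]]|<-] //; exists i. Qed.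

Lemma inl_top i : inl i \in top. Proof. exact: imset_f. Qed.

Lemma inr_top ij : inr ij \in top = false. Proof. by apply/imsetP => -[]. Qed.

(** As [k] is positive, there are at least four indices. *)
Lemma exists_other i j : exists l, (l != i) && (l != j).
Proof.
have : 0 < #|~: [set i; j]|.
  rewrite cardsCs setCK card_ord cards2 /n; case: (i != j) => /=; lia.
by case/card_gt0P => l; rewrite !inE negb_or; exists l.
Qed.

(** The linear functional over F_2 with support [X], applied to the indicator of [e]. *)
Definition parity X e : bool := odd #|e :&: X|.

Lemma parityU X s e : [disjoint s & e] -> parity X (s :|: e) = parity X s (+) parity X e.
Proof.
move=> dis; rewrite /parity setIUl cardsU (_ : _ :&: _ :&: _ = set0).
  by rewrite cards0 subn0 oddD.
by apply/eqP; rewrite setIACA (disjoint_setI0 dis) set0I.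
Qed.

Lemma parity1 X (a : V) : parity X [set a] = (a \in X).
Proof.
rewrite /parity; case: (boolP (a \in X)) => a_X.
  by rewrite (setIidPl _) ?cards1 ?sub1set.
by rewrite disjoint_setI0 ?cards0 ?disjoints1.
Qed.

(* The indicator of [l] and [l'] extends to a linear functional that vanishes
   on every member of the configuration. *)
Definition separator l l' : {set V} :=
  [set x | match x with
           | inl i => i \in [set l; l']
           | inr (i, j) => (i != j) && ((i \in [set l; l']) (+) (j \in [set l; l']))
                           || (i == j) && (i \in [set l; l'])
           end].

Lemma separator_config l l' e : l != l' -> l != ord0 -> l' != ord0 ->
  e \in config -> parity (separator l l') e = false.
Proof.
move=> ll' l0 l'0 /in_config[->|->|[i [j ->]]].
- by rewrite parity1 !inE eq_sym (negPf l0) eq_sym (negPf l'0).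
- rewrite /parity (_ : _ :&: _ = [set inr (l, l); inr (l', l')]).
    by rewrite cards2; case: eqP => // -[eq_l _]; rewrite eq_l eqxx in ll'.
  apply/setP => -[i|[i j]]; rewrite !inE ?inl_diagonal ?inr_diagonal //.
  have inrE (p q : 'I_n * 'I_n) : (inr p == inr q :> V) = (p == q) by [].
  rewrite !inrE !xpair_eqE; case: (eqVneq i j) => [->|ij] /=; first by rewrite !andbb.
  by symmetry; apply/negP => /orP[] /andP[/eqP ei /eqP ej]; rewrite ei ej eqxx in ij.
rewrite /edge setUC; have [->|ij] := eqVneq i j.
  rewrite setUid parityU ?parity1; last by rewrite disjoints1 inE.
  by rewrite !inE eqxx /= addbb.
have inlE p q : (inl p == inl q :> V) = (p == q) by [].
rewrite parityU ?disjoints1 ?inE // parityU ?disjoints1 ?inE ?inlE // !parity1 !inE.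
by rewrite ij (negPf ij) orbF; do 2!case: (_ || _).
Qed.

(** If [C] contained [inl i] with [i] nonzero and missed [inl j], the separator of [i] and [j] would
    meet it in [inl i] alone. *)
Lemma top_rigid C : inl ord0 \in C -> C \subset top ->
    (forall X, (forall e, e \in config -> parity X e = false) ->
       parity X C = false) ->
  C = seed \/ C = top.
Proof.
move=> C0 sub_top par; have [sub|/subsetPn[l lC l0]] := boolP (C \subset seed).
  by left; apply/eqP; rewrite eqEsubset sub sub1set.
right; apply/eqP; rewrite eqEsubset sub_top; apply/subsetPn => -[l' l'_top l'C].
have /imsetP[i _ l_i] := subsetP sub_top _ lC; have /imsetP[j _ l_j] := l'_top; subst.
have := par (separator i j); rewrite /parity (_ : _ :&: _ = [set inl i]).
  rewrite cards1 => odd1; suff: odd 1 = false by [].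
  apply: odd1 => e; apply: separator_config.
  - by apply: contraNneq l'C => <-.
  - by apply: contraNneq l0 => ->; rewrite inE.
  by apply: contraNneq l'C => ->.
apply/setP => x; rewrite in_set [x \in separator _ _]in_set in_set1.
have [xC|xC] := boolP (x \in C); last by symmetry; apply: contraNF xC => /eqP->.
have /imsetP[l _ x_l] := subsetP sub_top _ xC; subst.
have inlE p q : (inl p == inl q :> V) = (p == q) by [].
rewrite /= !inE inlE; have [lj|_] := eqVneq l j; last by rewrite orbF.
by rewrite lj (negPf l'C) in xC.
Qed.

(** [R] will select the members of [config] realized by words of [u], so [R C] says more than
    membership. An element of [C] outside [e] must share a member with each element of [e], and the
    elements [inr (i, j)] lie in very few members. *)
Lemma config_rigid (R : {set V} -> Prop) e C :
    (forall s, R s -> s \in config) ->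
    R e -> e \subset C ->
    (forall a b, a \in C -> b \in C -> exists s, [/\ R s, a \in s & b \in s]) ->
    (forall X, (forall s, s \in config -> parity X s = false) ->
       parity X C = false) ->
  R C \/ C = top /\ e = seed.
Proof.
move=> R_config Re eC pairs par.
have [sub|/subsetPn[b bC be]] := boolP (C \subset e).
  by left; have -> : C = e by apply/eqP; rewrite eqEsubset sub.
have adj a : a \in C -> exists s, [/\ R s, s \in config, a \in s & b \in s].
  by move=> aC; have [s [Rs a_s b_s]] := pairs a b aC bC; exists s; rewrite R_config.
case: (in_config (R_config e Re)) => [e_seed|e_diag|[i [j e_edge]]]; subst.
- have C0 : inl ord0 \in C by rewrite -sub1set.
  have [sub|/subsetPn[[i|[i j]] yC y_top]] := boolP (C \subset top).
    by case: (top_rigid C0 sub par) => C_E; [left; rewrite C_E | right].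
    by rewrite inl_top in y_top.
  have adj0 x : x \in C -> exists s, [/\ R s, s \in config, x \in s & inl ord0 \in s].
    by move=> xC; have [s [Rs x_s o_s]] := pairs x _ xC C0; exists s; rewrite R_config.
  (* Only [edge l l'] contains both [inr (l, l')] and [inl ord0]. *)
  have ij0 l l' : inr (l, l') \in C -> R (edge l l') /\ (ord0 == l) || (ord0 == l').
    case/adj0 => s [Rs /in_config[->|->|[i' [j' s_E]]]].
    - by rewrite inE.
    - by rewrite inl_diagonal.
    move: Rs; rewrite s_E inr_edge inl_edge => Rs /andP[/eqP-> /eqP->].
    by move=> ->.
  have [Rij o_ij] := ij0 _ _ yC.
  have C_sub : C \subset edge i j.
    apply/subsetP => x xC; have [s [Rs x_s y_s]] := pairs x _ xC yC.
    case: (in_config (R_config s Rs)) y_s x_s => [->|->|[i' [j' ->]]].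
    - by rewrite inE.
    - rewrite inr_diagonal => /eqP ij; subst.
      case/imsetP => l _ x_l; subst; have [_] := ij0 _ _ xC.
      by rewrite orbb => /eqP <-; move: o_ij; rewrite orbb => /eqP<-; rewrite !inE eqxx !orbT.
    by rewrite inr_edge => /andP[/eqP-> /eqP->].
  have [C_E|] := boolP (edge i j \subset C).
    by left; have -> : C = edge i j by apply/eqP; rewrite eqEsubset C_sub.
  case/subsetPn => z z_ij zC.
  have [l [lC l0 l_ij]] : exists l, [/\ inl l \notin C, l != ord0 &
      (i = ord0 /\ j = l) \/ (i = l /\ j = ord0)].
    have neq0 l : inl l \notin C -> l != ord0 by apply: contraNneq => ->.
    move: z_ij zC; rewrite !inE => /orP[/orP[]|] /eqP-> zC; last by rewrite yC in zC.
      exists i; split=> //; first exact: neq0.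
      by case/orP: o_ij (neq0 _ zC) => /eqP<-; rewrite ?eqxx //; right.
    exists j; split=> //; first exact: neq0.
    by case/orP: o_ij (neq0 _ zC) => /eqP<-; rewrite ?eqxx //; left.
  (* The endpoint [inl l] is missing from [C]. The separator of [l] and a further nonzero index [l']
     then meets [C] in [inr (i, j)] alone, against the parity condition. *)
  have [l' /andP[l'0 l'l]] := exists_other ord0 l.
  have sep0 p : p = ord0 -> (p \in [set l; l']) = false.
    by move=> ->; rewrite !inE ![ord0 == _]eq_sym (negPf l0) (negPf l'0).
  have := par (separator l l'); rewrite /parity (_ : _ :&: _ = [set inr (i, j)]).
    rewrite cards1 => odd1; suff: odd 1 = false by [].
    by apply: odd1 => e; apply: separator_config; rewrite // eq_sym.
  apply/setP => x; rewrite in_setI in_set1; apply/andP/eqP => [[xC xS]|->].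
    have := subsetP C_sub _ xC; rewrite !inE => /orP[/orP[]|] /eqP x_E; subst=> //.
      by case: l_ij => [[/sep0 i0 _]|[i_l _]]; [rewrite in_set i0 in xS | rewrite -i_l xC in lC].
    by case: l_ij => [[_ j_l]|[_ /sep0 j0]]; [rewrite -j_l xC in lC | rewrite in_set j0 in xS].
  have l_sep : l \in [set l; l'] by rewrite !inE eqxx.
  split=> //; rewrite in_set; case: l_ij => -[-> ->]; rewrite (sep0 ord0) // l_sep.
    by rewrite eq_sym l0.
  by rewrite l0.
(* Outside the diagonal, the only other element that shares a member with [inr (l, l)] is [inl l];
   this cannot hold for two indices at once. *)
- have b_inl l : b = inl l.
    have [|s [Rs /in_config s_E y_s b_s]] := adj (inr (l, l)).
      by apply: (subsetP eC); rewrite inr_diagonal.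
    case: s_E y_s b_s => [->|->|[i [j ->]]]; first by rewrite inE.
      by move=> _ b_d; rewrite b_d in be.
    rewrite inr_edge => /andP[/eqP-> /eqP->]; rewrite !inE orbb => /orP[] /eqP //.
    by move=> b_E; rewrite b_E inr_diagonal eqxx in be.
  have [l /andP[l0 _]] := exists_other ord0 ord0.
  by have := b_inl ord0; rewrite (b_inl l) => -[l_E]; rewrite l_E eqxx in l0.
have [|s [Rs /in_config s_E y_s b_s]] := adj (inr (i, j)).
  by apply: (subsetP eC); rewrite inr_edge !eqxx.
(* A member other than [edge i j] that contains [inr (i, j)] is the diagonal. Then [b] is some
   [inr (l, l)] with [l] different from [j], and no member contains both [b] and [inl j]. *)
have [ij /imsetP[l _ b_E]] : i = j /\ b \in diagonal.
  case: s_E y_s b_s => [->|->|[i' [j' ->]]]; first by rewrite inE.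
    by rewrite inr_diagonal => /eqP.
  by rewrite inr_edge => /andP[/eqP<- /eqP<-] b_ij; rewrite b_ij in be.
subst; rewrite inr_edge andbb in be.
have [|t [Rt /in_config t_E i_t b_t]] := adj (inl j).
  by apply: (subsetP eC); rewrite inl_edge eqxx.
case: t_E i_t b_t => [->|->|[i' [j' ->]]]; first by rewrite [in X in _ -> X]inE.
  by rewrite inl_diagonal.
rewrite inl_edge inr_edge => i_t /andP[/eqP l_i' /eqP l_j']; subst.
by move: i_t be; rewrite orbb eq_sym => ->.
Qed.

(** Limits how much of [top] one variable can contribute; it also keeps [top] out of [config]. *)
Lemma config_meets_top e : e \in config -> inl ord0 \in e ->
  #|(e :&: top) :\ inl ord0| <= 1.
Proof.
case/in_config => [->|->|[i [j ->]]]; last first.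
- rewrite inl_edge => /orP[] /eqP <-; [set x := inl j : V | set x := inl i : V];
  rewrite -(cards1 x); apply: subset_leq_card; apply/subsetP => -[l|y];
  rewrite !inE ?inr_top ?andbF //.
  + by rewrite orbF => /and3P[/negPf-> /=].
  + by rewrite orbF orbC => /and3P[/negPf-> /=].
- by rewrite inl_diagonal.
by move=> _; rewrite (_ : _ :\ _ = set0) ?cards0 //; apply/setP => x; rewrite !inE; case: eqP.
Qed.

Lemma card_top : #|top :\ inl ord0| = k.*2.+1.
Proof.
have := cardsD1 (inl ord0) top; rewrite inl_top card_imset ?card_ord; first by case.
by move=> i j [].
Qed.

End Configuration.

(** * Short identities of W hold in the semiring of set families *)

Section Transfer.

Variable k : nat.
Hypothesis k_gt0 : 0 < k.

Local Notation conf := (config k).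

Variables (u t : term) (v : nat -> family_algebra conf).
Hypotheses (uHt : satisfies H (u, t)) (uDt : satisfies D (u, t))
  (uGt : satisfies G (u, t)) (short : forall w, w \in words t -> size w < k.*2.+1)
  (u_n0 : sval (eval v u) != set0).

Lemma parity_join (X : {set 'I_k.*2.+2 + 'I_k.*2.+2 * 'I_k.*2.+2})
    (f : nat -> {set 'I_k.*2.+2 + 'I_k.*2.+2 * 'I_k.*2.+2}) w :
  pairwise (disj f) w ->
  parity X (join f w) = odd (count (fun x => parity X (f x)) w).
Proof.
elim: w => [_|x w IH].
  by rewrite /join big_nil /parity set0I cards0.
rewrite -cat1s pairwise_cat allrel_disj => /and3P[dis _ /IH pw].
rewrite join_cat parityU // pw count_cat oddD /= addn0; congr addb.
by rewrite /join big_seq1; case: parity.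
Qed.

(** [config_rigid] is applied to the translate by [p] of the join of [w]: [H] supplies the pairs,
    [D] a word inside [w], and [G] the parities. The exceptional value [top] is excluded by the
    length of [w]. *)
Lemma realization_transfer w f : w \in words t -> selects v f w ->
  pairwise (disj f) w /\
  exists w' f', [/\ w' \in words u, selects v f' w' & join f w = join f' w'].
Proof.
move=> w_t sel_w.
have /extensibleP[_ _ [p p_u]] := family_extensible u_n0.
have [g sel_g] : exists g, selects v g (flatten (words u)).
  apply: selects_exists => x /flattenP[r r_u x_r]; exact: eval_vars_neq0 u_n0 _ _ r_u x_r.
(* One selection has to serve [w] and all words of [u] at once, so that their joins are
   comparable. *)
pose f' x := if x \in w then f x else g x.
have f'E : {in w, f' =1 f} by move=> x x_w; rewrite /f' x_w.
rewrite -(eq_join f'E) -(eq_pairwise_disj f'E).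
have sel r : r \in words u -> selects v f' r.
  move=> r_u x x_r; rewrite /f'; case: ifP => [/sel_w //|_].
  by apply: sel_g; apply/flattenP; exists r.
have {}sel_w : selects v f' w by move=> x x_w; rewrite f'E ?sel_w.
have real r : r \in words u -> [/\ pairwise (disj f') r, uniq r,
    [disjoint p & join f' r] & p :|: join f' r \in conf].
  move=> r_u; have [pw j_u] := realize_in_eval u_n0 r_u (sel r r_u).
  by have [] := p_u _ j_u; rewrite pw (pairwise_disj_uniq (sel r r_u) pw).
have pair x y : 1 < count (mem [:: x; y]) w ->
    exists r, [/\ r \in words u, x \in r, y \in r & x != y].
  case/(H_pair uHt w_t) => r r_u.
  by case/count_pair; [case: (real r r_u) | exists r].
have pw : pairwise (disj f') w.
  apply: pairwise_of_count => x y /pair[r [r_u x_r y_r xy]].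
  by have [pr _ _ _] := real r r_u; apply: pairwise_disj_mem pr _ _ _.
split=> //.
have two x y : x \in w -> y \in w ->
    exists r, [/\ r \in words u, x \in r & y \in r].
  move=> x_w y_w; have [->|xy] := eqVneq x y.
    by have [r r_u y_r] := H_content uHt w_t y_w; exists r.
  have [|r [r_u x_r y_r _]] := @pair x y; last by exists r.
  rewrite -size_filter; apply: (@uniq_leq_size _ [:: x; y]); first by rewrite /= inE xy.
  by move=> z; rewrite mem_filter !inE => /orP[]/eqP->; rewrite eqxx ?orbT.
have pw_dis : [disjoint p & join f' w].
  apply/disjoint_joinP => x x_w; have [r [r_u x_r _]] := two x x x_w x_w.
  have [_ _ dis _] := real r r_u; exact: disjointWr (sub_join f' x_r) dis.
pose R s := exists2 r, r \in words u & s = p :|: join f' r.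
have R_conf s : R s -> s \in conf by case=> r /real[_ _ _ r_conf] ->.
have [w0 w0_u w0_w] := D_support uDt w_t.
have sub_w0 : p :|: join f' w0 \subset p :|: join f' w.
  apply: setUS; apply/subsetP => a /joinP[x x_w0 a_x]; apply/joinP.
  by exists x => //; exact: w0_w.
have [x0 x0_w] : exists x, x \in w.
  by case: (w) (word_neq0 w_t) => // x r _; exists x; exact: mem_head.
have R_pair a b : a \in p :|: join f' w -> b \in p :|: join f' w ->
    exists s, [/\ R s, a \in s & b \in s].
  (* Each element is attributed to a letter of [w]. Elements of [p] lie in every translate and may
     be attributed to any letter. *)
  have cover c : c \in p :|: join f' w ->
      exists2 x, x \in w & forall r, x \in r -> c \in p :|: join f' r.
    rewrite inE => /orP[c_p|/joinP[x x_w c_x]].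
      by exists x0 => // r _; rewrite inE c_p.
    exists x => // r x_r; rewrite inE; apply/orP; right.
    by apply/joinP; exists x.
  move=> /cover[x x_w a_x] /cover[y y_w b_y].
  have [r [r_u x_r y_r]] := two x y x_w y_w.
  by exists (p :|: join f' r); split; [exists r | exact: a_x | exact: b_y].
have par X : (forall s, s \in conf -> parity X s = false) ->
    parity X (p :|: join f' w) = false.
  move=> X_conf; rewrite parityU // parity_join //.
  (* Every word of [u] is completed by [p] to a member of [conf], so its parity is that of [p]; [G]
     passes this on to [w]. *)
  rewrite (G_parity (b := fun x => parity X (f' x)) (c := parity X p) uGt _ w_t).
    by rewrite addbb.
  move=> r r_u; have [pr _ dis r_conf] := real r r_u.
  have := X_conf _ r_conf; rewrite parityU // parity_join //.
  by case: parity (odd _) => [] [].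
have R0 : R (p :|: join f' w0) by exists w0.
case: (config_rigid k_gt0 R_conf R0 sub_w0 R_pair par) => [[r r_u C_E]|[C_top e_seed]].
  exists r, f'; split=> //; first exact: sel.
  by have [_ _ dis _] := real r r_u; apply: disjoint_setUI C_E.
(* Here [inl ord0] belongs to the value of a letter [y] of [w0]. Every letter of [w] shares a word
   of [u] with [y], so its value has at most one element besides [inl ord0]; the union over [w] is
   then too small to be [top]. *)
exfalso.
have [y y_w0] : exists y, y \in w0.
  by case: (w0) (word_neq0 w0_u) => // x r _; exists x; exact: mem_head.
have y0 : inl ord0 \in f' y.
  have /set0Pn[a a_y] := family_elt_neq0 (sel w0 w0_u y y_w0).
  have : a \in p :|: join f' w0.
    by rewrite inE; apply/orP; right; apply/joinP; exists y.
  by rewrite e_seed inE => /eqP <-.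
have small x : x \in w -> #|f' x :\ inl ord0| <= 1.
  move=> x_w; have [r [r_u x_r y_r]] := two x y x_w (w0_w y y_w0).
  have [_ _ _ r_conf] := real r r_u.
  have in_r z : z \in r -> f' z \subset p :|: join f' r.
    move=> z_r; apply: subset_trans (subsetUr _ _); exact: sub_join.
  apply: leq_trans (config_meets_top r_conf (subsetP (in_r y y_r) _ y0)).
  apply: subset_leq_card; apply: setSD; rewrite subsetI in_r // -C_top.
  apply: subset_trans (subsetUr _ _); exact: sub_join.
have p0 : p = set0.
  apply/eqP/set0Pn => -[a a_p]; have : a \in seed k by rewrite -e_seed inE a_p.
  rewrite inE => /eqP a0; have := disjointFr pw_dis a_p; rewrite a0.
  by move/joinP; case; exists y => //; exact: w0_w.
have := short w_t; rewrite ltnNge -card_top -C_top p0 set0U; case/negP.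
elim: (w) small => [_|x r IH small]; first by rewrite /join big_nil set0D cards0.
rewrite /join big_cons setDUl; apply: leq_trans (leq_card_setU _ _) _.
rewrite -[size _]add1n leq_add ?small ?mem_head // IH // => z z_r.
by apply: small; rewrite inE z_r orbT.
Qed.

End Transfer.

Lemma eval_transfer k u t (v : nat -> family_algebra (config k)) : 0 < k ->
    satisfies H (u, t) -> satisfies D (u, t) -> satisfies G (u, t) ->
    (forall w, w \in words t -> size w < k.*2.+1) ->
    sval (eval v u) != set0 ->
  sval (eval v t) != set0 /\ sval (eval v t) \subset sval (eval v u).
Proof.
move=> k0 uHt uDt uGt short u_n0.
have transfer := realization_transfer k0 uHt uDt uGt short u_n0.
split; last first.
  apply/subsetP => s /eval_realized[w [f [w_t /(transfer _ _ w_t)]]].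
  case=> _ [w' [f' [w'_u sel' ->]]] ->.
  by have [] := realize_in_eval u_n0 w'_u sel'.
have /extensibleP[_ _ [p p_u]] := family_extensible u_n0.
apply: (@eval_neq0 _ _ _ _ p) => [w x w_t x_w|w f w_t sel].
  by have [r r_u x_r] := H_content uHt w_t x_w; apply: eval_vars_neq0 u_n0 _ _ r_u x_r.
have [pw [w' [f' [w'_u sel' ->]]]] := transfer _ _ w_t sel.
by have [_ /p_u[]] := realize_in_eval u_n0 w'_u sel'.
Qed.

Lemma family_algebra_satisfies k e : 0 < k ->
    satisfies H e -> satisfies D e -> satisfies G e ->
    (forall w, w \in words e.1 ++ words e.2 -> size w < k.*2.+1) ->
  satisfies (family_algebra (config k)) e.
Proof.
case: e => u t k0 eH eD eG short v /=; apply: val_inj => /=.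
have trans := @eval_transfer k _ _ v k0.
have short1 w : w \in words u -> size w < k.*2.+1.
  by move=> w_u; apply: short; rewrite mem_cat w_u.
have short2 w : w \in words t -> size w < k.*2.+1.
  by move=> w_t; apply: short; rewrite mem_cat w_t orbT.
have fwd := trans _ _ eH eD eG short2.
have bwd := trans _ _ (satisfies_sym eH) (satisfies_sym eD) (satisfies_sym eG) short1.
have [u0|u_n0] := eqVneq (sval (eval v u)) set0.
  by have [->//|/bwd[]] := eqVneq (sval (eval v t)) set0; rewrite u0 eqxx.
have [t_n0 tu] := fwd u_n0; have [_ ut] := bwd t_n0.
by apply/eqP; rewrite eqEsubset ut tu.
Qed.

(** * The identity F = F + T *)

Fixpoint prod_term (w : seq nat) : term :=
  match w with
  | [::] => Var 0
  | x :: w' => if w' is [::] then Var x else Mul (Var x) (prod_term w')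
  end.

Fixpoint sum_term (ws : seq (seq nat)) : term :=
  match ws with
  | [::] => Var 0
  | w :: ws' => if ws' is [::] then prod_term w else Add (prod_term w) (sum_term ws')
  end.

Lemma words_prod_term w : w != [::] -> words (prod_term w) = [:: w].
Proof.
elim: w => // x [|y w] IH _ //.
by rewrite -[prod_term _]/(Mul (Var x) (prod_term (y :: w))) /= IH.
Qed.

Lemma words_sum_term ws : ws != [::] -> [::] \notin ws -> words (sum_term ws) = ws.
Proof.
elim: ws => // w [|w' ws] IH _; rewrite in_cons negb_or eq_sym => /andP[w_n ws_n].
  by rewrite /= words_prod_term.
rewrite -[sum_term _]/(Add (prod_term w) (sum_term (w' :: ws))).
by rewrite -[words _]/(words (prod_term w) ++ words (sum_term (w' :: ws))) words_prod_term // IH.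
Qed.

Section Witness.

Variable k : nat.
Hypothesis k_gt0 : 0 < k.

Local Notation I := 'I_k.*2.+2.
Local Notation V := (I + I * I)%type.

Definition set_word (s : {set V}) : seq nat := [seq pickle x | x <- enum s].

Definition base : term := sum_term [seq set_word s | s <- enum (config k)].
Definition base_top : term :=
  sum_term (set_word (top k) :: [seq set_word s | s <- enum (config k)]).

Lemma set_word_neq0 (s : {set V}) : s != set0 -> set_word s != [::].
Proof.
by case/set0Pn => x x_s; rewrite -size_eq0 size_map -cardE -lt0n; apply/card_gt0P; exists x.
Qed.

Lemma config_neq0 s : s \in config k -> s != set0.
Proof.
case/in_config => [->|->|[i [j ->]]]; apply/set0Pn.
- by exists (inl ord0); rewrite inE.
- by exists (inr (ord0, ord0)); rewrite inr_diagonal.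
by exists (inl i); rewrite inl_edge eqxx.
Qed.

Lemma words_base : words base = [seq set_word s | s <- enum (config k)].
Proof.
apply: words_sum_term.
  rewrite -size_eq0 size_map -cardE -lt0n; apply/card_gt0P.
  by exists (seed k); exact: seed_config.
apply/mapP => -[s]; rewrite mem_enum => /config_neq0/set_word_neq0; by case: set_word.
Qed.

Lemma words_base_top : words base_top = set_word (top k) :: words base.
Proof.
rewrite words_base; apply: words_sum_term => //; rewrite inE negb_or.
rewrite eq_sym set_word_neq0; last by apply/set0Pn; exists (inl ord0); exact: inl_top.
apply/mapP => -[s]; rewrite mem_enum => /config_neq0/set_word_neq0; by case: set_word.
Qed.

Lemma word_base s : s \in config k -> set_word s \in words base.
Proof. by move=> s_c; rewrite words_base map_f // mem_enum. Qed.

Lemma base_word w : w \in words base -> exists2 s, s \in config k & w = set_word s.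
Proof.
by rewrite words_base => /mapP[s]; rewrite mem_enum => s_c ->; exists s.
Qed.

Lemma D_base : satisfies D (base, base_top).
Proof.
move=> v /=; rewrite !evalD words_base_top /=.
have [/allP top_v|//] := boolP (all v _); apply/hasP.
exists (set_word (seed k)); first exact: word_base (seed_config k).
apply/allP => x /mapP[y]; rewrite mem_enum inE => /eqP-> ->.
by apply/top_v/map_f; rewrite mem_enum inl_top.
Qed.

Lemma hsum_word v (s : {set V}) : hsum v (set_word s) = \sum_(x in s) hval (v (pickle x)).
Proof. by rewrite /hsum big_map big_enum. Qed.

(** If two points of [top] have positive weight, the edge joining them already has weight at least
    2. If only one has, its loop [edge i i] weighs at least as much. *)
Lemma H_base : satisfies H (base, base_top).
Proof.
move=> v /=; apply: hval_inj; apply/eqP; rewrite eqn_leq; apply/andP; split.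
  have [w w_b ->] := evalH_attained v base; apply: evalH_ge.
  by rewrite words_base_top inE w_b orbT.
have [w] := evalH_attained v base_top; rewrite words_base_top inE.
case/orP => [/eqP->|w_b] ->; last exact: evalH_ge.
rewrite hsum_word big_imset /=; last by move=> i j _ _ [].
pose h (x : V) := hval (v (pickle x)).
rewrite (eq_bigr (fun i => h (inl i))) //.
have edge_le i j : minn 2 (\sum_(x in edge i j) h x) <= hval (eval v base).
  by rewrite -hsum_word; apply/evalH_ge/word_base/edge_config.
have [i hi|h0] := pickP (fun i => 0 < h (inl i)); last first.
  by rewrite big1 // => i _; have := h0 i; case: (h _).
have [j /andP[ji hj]|h0] := pickP (fun j => (j != i) && (0 < h (inl j))).
  apply: leq_trans (edge_le i j); rewrite leq_min geq_minl /=.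
  apply: leq_trans (geq_minl _ _) _.
  rewrite (big_setD1 (inl i)) ?inl_edge ?eqxx //=.
  rewrite (big_setD1 (inl j)) /=; last by rewrite !inE eqxx orbT andbT.
  by rewrite addnA; apply: leq_trans (leq_addr _ _); exact: leq_add hi hj.
apply: leq_trans (edge_le i i); rewrite (bigD1 i) //= big1; last first.
  by move=> j ji; have := h0 j; rewrite ji; case: (h _).
rewrite addn0 leq_min geq_minl /=; apply: leq_trans (geq_minr _ _) _.
by rewrite (big_setD1 (inl i)) ?inl_edge ?eqxx //= leq_addr.
Qed.

Lemma gprod_word v (s : {set V}) :
  gprod v (set_word s) = \big[G_mul/G1]_(x in s) v (pickle x).
Proof. by rewrite /gprod big_map big_enum. Qed.

(** If all words of [base] have the unit [c] as value, the product of the loops [edge i i] is an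
    even power of [c], hence 1. It is also the product of [top] and the diagonal, so [top] has value
    [c]. *)
Lemma G_base : satisfies G (base, base_top).
Proof.
move=> v /=; have eqG (x y : G) : (forall c, x = toG c <-> y = toG c) -> x = y.
  move=> h; case: x {h} (h false).1 (h true).1 (h false).2 (h true).2.
  - by move=> /(_ erefl).
  - by move=> _ /(_ erefl).
  by case: y => // _ _; [move=> /(_ erefl) | move=> _ /(_ erefl)].
apply: eqG => c; split=> /evalG h; apply/evalG => w; last first.
  by move=> w_b; apply: h; rewrite words_base_top inE w_b orbT.
rewrite words_base_top inE => /orP[/eqP->|]; last exact: h.
pose g (x : V) : G := v (pickle x).
have edge_c i : G_mul (g (inl i)) (g (inr (i, i))) = toG c.
  rewrite -(h (set_word (edge i i))) ?word_base ?edge_config // gprod_word.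
  by rewrite /edge setUid big_setU1 ?inE //= big_set1.
have diag_c : \big[G_mul/G1]_i g (inr (i, i)) = toG c.
  rewrite -(h (set_word (diagonal k))) ?word_base ?diagonal_config // gprod_word.
  by rewrite big_imset //= => i j _ _ [].
rewrite gprod_word big_imset /=; last by move=> i j _ _ [].
have sq x : G_mul (toG c) (G_mul (toG c) x) = x by case: (c) x => [] [].
have : \big[G_mul/G1]_(i < k.*2.+2) G_mul (g (inl i)) (g (inr (i, i))) = G1.
  rewrite (eq_bigr (fun=> toG c)) // big_const_ord.
  by elim: (k) => [|m IH]; rewrite ?doubleS [LHS]/= sq.
rewrite big_split /= diag_c => prod1.
change (\big[G_mul/G1]_(i : I) g (inl i) = toG c).
have cancel x : G_mul x (toG c) = G1 -> x = toG c by case: (c) x => [] [].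
exact: cancel prod1.
Qed.

Lemma config_cover (x : V) : exists2 s, s \in config k & x \in s.
Proof.
case: x => [i|[i j]]; [exists (edge i i) | exists (edge i j)]; rewrite ?edge_config //.
  by rewrite inl_edge eqxx.
by rewrite inr_edge !eqxx.
Qed.

Lemma point_extensible (x : V) : extensible (config k) [set [set x]].
Proof.
apply/extensibleP; split.
- by apply/set0Pn; exists [set x]; rewrite inE.
- by move=> s; rewrite inE => /eqP->; apply/set0Pn; exists x; rewrite inE.
have [s s_c x_s] := config_cover x; exists (s :\ x) => r; rewrite inE => /eqP->.
by rewrite disjoint_sym disjoints1 setUC setD1K // in_setD1 eqxx.
Qed.

(** Under this valuation [set_word s] has [s] as its only realization. Codes of no element get the
    junk value [set0]. *)
Definition point (c : nat) : family_algebra (config k) :=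
  to_family (config k) (if unpickle c is Some x then [set [set (x : V)]] else set0).

Lemma sval_point (x : V) : sval (point (pickle x)) = [set [set x]].
Proof. by rewrite /point pickleK extensible_to_family // point_extensible. Qed.

Lemma selects_word f (s : {set V}) : selects point f (set_word s) ->
  {in s, forall x, f (pickle x) = [set x]}.
Proof.
move=> sel x x_s; apply/set1P; rewrite -sval_point; apply: sel.
by apply: map_f; rewrite mem_enum.
Qed.

Lemma join_word f (s : {set V}) : selects point f (set_word s) -> join f (set_word s) = s.
Proof.
move=> /selects_word sel; apply/setP => x; apply/joinP/idP.
  case=> z /mapP[y]; rewrite mem_enum => y_s ->.
  by rewrite sel // inE => /eqP->.
by move=> x_s; exists (pickle x); rewrite ?sel ?set11 ?map_f ?mem_enum.
Qed.

Lemma point_neq0 w x : w \in words base_top -> x \in w -> sval (point x) != set0.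
Proof.
rewrite words_base_top inE => w_b x_w.
have [s w_s] : exists s, w = set_word s.
  by case/orP: w_b => [/eqP->|/base_word[s _ ->]]; [exists (top k) | exists s].
move: x_w; rewrite w_s => /mapP[y _ ->]; rewrite sval_point.
by apply/set0Pn; exists [set y]; rewrite inE.
Qed.

Lemma base_neq0 : sval (eval point base) != set0.
Proof.
apply: (@eval_neq0 _ _ _ _ set0) => [w x w_b|w f /base_word[s s_c ->] sel].
  by apply: point_neq0; rewrite words_base_top inE w_b orbT.
rewrite join_word // set0U s_c -setI_eq0 set0I; split=> //.
rewrite /set_word pairwise_map; apply: (@sub_in_pairwise _ (mem s) (fun x y => x != y)).
- move=> x y x_s y_s xy; rewrite /= /disj !(selects_word sel) //.
  by rewrite disjoints1 inE.
- by apply/allP => x; rewrite mem_enum.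
by rewrite -uniq_pairwise enum_uniq.
Qed.

(** If both sides agreed, [base_top] would be nonzero and some translate of [top] would lie in
    [config], but no member with [inl ord0] contains that much of [top]. *)
Lemma family_base : ~ satisfies (family_algebra (config k)) (base, base_top).
Proof.
move/(_ point) => /= e; have := base_neq0; rewrite e => n0.
have top_w : set_word (top k) \in words base_top by rewrite words_base_top mem_head.
have [f sel] := selects_exists (fun x => point_neq0 top_w (x := x)).
have [_] := realize_in_eval n0 top_w sel; rewrite join_word //.
have /extensibleP[_ _ [p p_S]] := family_extensible n0.
case/p_S => _ top_c; have := config_meets_top top_c.
rewrite inE inl_top orbT (setIidPr (subsetUr _ _)) card_top => /(_ isT).
by case: (k) k_gt0.
Qed.

End Witness.

(** * Absence of a finite basis for [W] and [HDG] *)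

Lemma exists_word_bound (s : seq identity) :
  exists m, forall e, List.In e s ->
    forall w, w \in words e.1 ++ words e.2 -> size w <= m.
Proof.
elim: s => [|e s [m h]]; first by exists 0.
exists (\max_(w <- words e.1 ++ words e.2) size w + m) => e' /= [<-|/h le_m] w w_e.
  by apply: leq_trans (leq_addr _ _); apply: (leq_bigmax_seq w).
by apply: leq_trans (leq_addl _ _); exact: le_m.
Qed.

(** Only the identities of [K] matter, so one argument serves both the three generators and their
    product. *)
Lemma not_finitely_based_variety (K : algebra -> Prop) :
    (forall e, (forall B, K B -> satisfies B e) <->
       [/\ satisfies H e, satisfies D e & satisfies G e]) ->
  ~ finitely_based_variety (generated_variety K).
Proof.
move=> K_HDG [s sP]; have [m bound] := exists_word_bound s.
have e_HDG e : List.In e s -> [/\ satisfies H e, satisfies D e & satisfies G e].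
  move=> e_s; apply/K_HDG => B KB.
  have /sP : generated_variety K B by move=> V _; apply.
  exact.
(* The choice [m.+1] is positive and puts the length bound [k.*2.+1] above [m]. *)
have /sP gen : is_model (fun e => List.In e s) (family_algebra (config m.+1)).
  move=> e e_s; have [eH eD eG] := e_HDG e e_s.
  apply: family_algebra_satisfies => // w /(bound e e_s) le_m; lia.
apply: (@family_base m.+1) => //.
apply: (gen (is_model (eq (base m.+1, base_top m.+1)))) => [|B KB _ <-|] //.
  by exists (eq (base m.+1, base_top m.+1)).
by apply/(K_HDG _).2/KB; split; [exact: H_base | exact: D_base | exact: G_base].
Qed.

Theorem corollary6p3 :
  ~ finitely_based_variety W /\ ~ finitely_based HDG /\
  finitely_based H /\ finitely_based D /\ finitely_based G.
Proof.
split.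
  apply: not_finitely_based_variety => e; split=> [K_e|[eH eD eG] B [->|->|->]] //.
  by split; apply: K_e; [constructor 1 | constructor 2 | constructor 3].
split; last first.
  by split; [exact: H_finitely_based | split; [exact: D_finitely_based | exact: G_finitely_based]].
have eval_prod A B v t : eval (A := prod_algebra A B) v t =
    (eval (fun n => (v n).1) t, eval (fun n => (v n).2) t).
  by elim: t => [n|t1 IH1 t2 IH2|t1 IH1 t2 IH2] /=; rewrite ?IH1 ?IH2 //; case: (v n).
apply: not_finitely_based_variety => e; split=> [K_e|[eH eD eG] B -> v]; last first.
  by rewrite !eval_prod eH eD eG.
have {}K_e := K_e HDG erefl; split=> v.
- have := K_e (fun n => ((v n, false), G1)).
  by rewrite !eval_prod /= => -[].
- have := K_e (fun n => ((H1, v n), G1)).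
  by rewrite !eval_prod /= => -[].
have := K_e (fun n => ((H1, false), v n)).
by rewrite !eval_prod /= => -[].
Qed.
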